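(* Let $k\ge1$ and let $f:D\to\Lambda\times\mathbb{R}^u\times\mathbb{R}^s$ be a $C^{k+1}$ map satisfying the covering conditions, the rate conditions of order $k$ and the backward cone conditions (so that $W^{cu}=\{(\lambda,x,w^{cu}(\lambda,x)):\lambda\in\Lambda,x\in\overline B_u(R)\}$ for a function $w^{cu}:\Lambda\times\overline B_u(R)\to\overline B_s(R)$). Let $M\in(0,L)$ and $\xi=\inf_{z\in D}m[\partial f_{(\lambda,x)}/\partial(\lambda,x)(P(z))]-M\sup_{z\in D}\|\partial f_{(\lambda,x)}/\partial y(z)\|$, $\mu=\sup_{z\in D}\{\|\partial f_y/\partial y(z)\|+\frac1M\|\partial f_y/\partial(\lambda,x)(z)\|\}$. If $\xi/\mu>1$, then $w^{cu}$ is Lipschitz with constant $M$.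
   Context: $c,u,s$ positive integers, $\Lambda=(\mathbb{R}/\mathbb{Z})^c$, $R_\Lambda=\tfrac12$; points are ''in the same chart'' if their $\lambda$-components have lifts to $\mathbb{R}^c$ at distance $\le R_\Lambda$; differences, norms, cones, derivatives and Lipschitz constants are computed in such lifts; $\overline B_c(\lambda,R_\Lambda)$ closed ball about a lift of $\lambda$. $B_n(R),\overline B_n(R)$ open/closed balls at $0$; Euclidean norms. $0<R<R_\Lambda/2$, $D=\Lambda\times\overline B_u(R)\times\overline B_s(R)$, $z=(\lambda,x,y)$, projections $\pi_\lambda,\pi_x,\pi_y,\pi_{(\lambda,x)},\pi_{(\lambda,y)}$, $f=(f_\lambda,f_x,f_y)$. $m(A)=\max\{c:\|Av\|\ge c\|v\|\}$, $m(\mathbf A)=\inf_{A\in\mathbf A}m(A)$; $[\partial g/\partial w(U)]$ = matrices with $(i,j)$ entry in $[\inf_U\partial g_i/\partial w_j,\sup_U\partial g_i/\partial w_j]$; $P(z)=\{w\in D:\|\pi_\lambda w-\pi_\lambda z\|\le R_\Lambda/2\}$. Fix $L\in(2R/R_\Lambda,1)$; constants $\mu_{s,1}=\sup_{D}\{\|\partial_y f_y\|+\frac1L\|\partial_{(\lambda,x)}f_y\|\}$, $\mu_{s,2}=\sup_D\{\|\partial_yf_y\|+L\|\partial_yf_{(\lambda,x)}\|\}$, $\xi_{u,1}=\inf_D\{m(\partial_xf_x)-\frac1L\|\partial_{(\lambda,y)}f_x\|\}$, $\xi_{u,1,P}=\inf_{z\in D}m[\partial_xf_x(P(z))]-\frac1L\sup_D\|\partial_{(\lambda,y)}f_x\|$,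 $\xi_{u,2}=\inf_D\{m(\partial_xf_x)-L\|\partial_xf_{(\lambda,y)}\|\}$, $\mu_{cs,1}=\sup_D\{\|\partial_{(\lambda,y)}f_{(\lambda,y)}\|+L\|\partial_xf_{(\lambda,y)}\|\}$, $\mu_{cs,2}=\sup_D\{\|\partial_{(\lambda,y)}f_{(\lambda,y)}\|+\frac1L\|\partial_{(\lambda,y)}f_x\|\}$, $\xi_{cu,1}=\inf_D\{m(\partial_{(\lambda,x)}f_{(\lambda,x)})-L\|\partial_yf_{(\lambda,x)}\|\}$, $\xi_{cu,1,P}=\inf_{z\in D}m[\partial_{(\lambda,x)}f_{(\lambda,x)}(P(z))]-L\sup_D\|\partial_yf_{(\lambda,x)}\|$, $\xi_{cu,2}=\inf_D\{m(\partial_{(\lambda,x)}f_{(\lambda,x)})-\frac1L\|\partial_{(\lambda,x)}f_y\|\}$. Rate conditions of order $k$: all $\xi$'s positive; $\mu_{s,1}<1<\xi_{u,1,P}$; $\mu_{cs,1}<\xi_{u,1,P}$; $\mu_{s,1}<\xi_{cu,1,P}$; for $1\le j\le k$: $\mu_{cs,1}^{j+1}<\xi_{u,2}$, $\mu_{s,2}<\xi_{cu,1}^{j+1}$; $\mu_{cs,2}<\xi_{u,1}$; $\mu_{s,1}<\xi_{cu,2}$. Cones $J_s(z,M)=\{\|(\lambda,x)-\pi_{(\lambda,x)}z\|\le M\|y-\pi_yz\|\}$, $J_u(z,M)=\{\|(\lambda,y)-\pi_{(\lambda,y)}z\|\le M\|x-\pi_xz\|\}$. $W^{cu}=\{z:$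 there is a full backward trajectory $\{z_i\}_{i\le0}$ ($z_0=z$, $f(z_{i-1})=z_i$) of $z$ in $D\}$. Backward cone conditions: if $z_1,z_2,f(z_1),f(z_2)\in D$ and $f(z_1)\in J_s(f(z_2),1/L)$ then $z_1\in J_s(z_2,1/L)$. Covering conditions: with $D_\lambda=\overline B_c(\lambda,R_\Lambda)\times\overline B_u(R)\times\overline B_s(R)$, $D^+_\lambda=\overline B_c(\lambda,R_\Lambda)\times\overline B_u(R)\times\partial B_s(R)$, $D^-_\lambda=\overline B_c(\lambda,R_\Lambda)\times\partial B_u(R)\times B_s(R)$: for each $z\in D$ there exist $\lambda^*$, a homotopy $h:[0,1]\times U\to B_c(\lambda^*,R_\Lambda)\times\mathbb{R}^u\times\mathbb{R}^s$ ($U=J_u(z,1/L)\cap D$) and linear $A$ with $h_0=f|_U$, $h_\alpha(U\cap D^-_{\pi_\lambda z})\cap D_{\lambda^*}=\emptyset$, $h_\alpha(U)\cap D^+_{\lambda^*}=\emptyset$ for all $\alpha$, $h_1(\lambda,x,y)=(\lambda^*,Ax,0)$, $A(\partial B_u(R))\subset\mathbb{R}^u\setminus\overline B_u(R)$. *)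

(* Defs.v *)
From HB Require Import structures.
From mathcomp Require Import all_boot all_order all_algebra.
From mathcomp Require Import all_classical all_reals all_analysis.
Set Implicit Arguments. Unset Strict Implicit. Unset Printing Implicit Defensive.
Import Order.TTheory GRing.Theory Num.Theory.
Import numFieldNormedType.Exports.
Local Open Scope classical_set_scope.
Local Open Scope ring_scope.

(* Points of the lifted phase space R^c x R^u x R^s are row vectors of size
   (c + u) + s; lambda-coordinates are lifts to R^c of points of (R/Z)^c. *)
Section Defs.
Variable R : realType.
Variables c u s : nat.
Notation P := 'rV[R]_(c + u + s).

Definition enorm p q (v : 'M[R]_(p, q)) : R := Num.sqrt (\sum_i \sum_j v i j ^+ 2).

Definition opnorm p q (A : 'M[R]_(p, q)) : R :=
  sup [set enorm (v *m A) | v in [set v : 'rV[R]_p | enorm v <= 1]].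
Definition mlow p q (A : 'M[R]_(p, q)) : R :=
  sup [set k | forall v : 'rV[R]_p, k * enorm v <= enorm (v *m A)].
Definition ihull p q (S : set 'M[R]_(p, q)) : set 'M[R]_(p, q) :=
  [set B | forall i j, inf [set A i j | A in S] <= B i j /\
                       B i j <= sup [set A i j | A in S]].
Definition mset p q (S : set 'M[R]_(p, q)) : R := inf [set mlow B | B in ihull S].

Definition lam (z : P) : 'rV[R]_c := lsubmx (lsubmx z).
Definition xc (z : P) : 'rV[R]_u := rsubmx (lsubmx z).
Definition yc (z : P) : 'rV[R]_s := rsubmx z.
Definition lx (z : P) : 'rV[R]_(c + u) := lsubmx z.
Definition ly (z : P) : 'rV[R]_(c + s) := row_mx (lam z) (yc z).
Definition mkpt (l : 'rV[R]_c) (x : 'rV[R]_u) (y : 'rV[R]_s) : P := row_mx (row_mx l x) y.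

Definition iL (i : 'I_c) : 'I_(c + u + s) := lshift s (lshift u i).
Definition iX (i : 'I_u) : 'I_(c + u + s) := lshift s (rshift c i).
Definition iY (i : 'I_s) : 'I_(c + u + s) := rshift (c + u) i.
Definition iLX (i : 'I_(c + u)) : 'I_(c + u + s) := lshift s i.
Definition iLY (i : 'I_(c + s)) : 'I_(c + u + s) :=
  match fintype.split i with inl a => iL a | inr b => iY b end.

(* integer vectors and the deck transformations of R^c -> (R/Z)^c *)
Definition intvec (n : 'rV[R]_c) := forall i, n 0 i \is a Num.int.
Definition shift (n : 'rV[R]_c) : P := mkpt n 0 0.
(* same point of Lambda x R^u x R^s *)
Definition equivP (p q : P) := exists n, intvec n /\ p = q + shift n.

Definition RLam : R := 2^-1.
Definition Dl (Rad : R) (z : P) := enorm (xc z) <= Rad /\ enorm (yc z) <= Rad.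

Definition is_lift (Rad : R) (F : P -> P) :=
  forall z n, Dl Rad z -> intvec n -> exists m, intvec m /\ F (z + shift n) = F z + shift m.

(* partial derivatives; Jacobian convention: Jac z i j = d F_j / d z_i *)
Definition evec (i : 'I_(c + u + s)) : P := delta_mx 0 i.
Definition dpart (g : P -> R) (l : seq 'I_(c + u + s)) : P -> R :=
  foldr (fun i h => fun w => derive h w (evec i)) g l.
Definition Cr_on (r : nat) (O : set P) (g : P -> R) :=
  forall l : seq 'I_(c + u + s), (size l <= r)%N ->
    (forall w, O w -> {for w, continuous (dpart g l)}) /\
    ((size l < r)%N -> forall i w, O w -> derivable (dpart g l) w (evec i)).
Definition Cr_map (r : nat) (Rad : R) (F : P -> P) :=
  exists O : set P, open O /\ Dl Rad `<=` O /\ forall j, Cr_on r O (fun w => F w 0 j).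

Definition Jac (F : P -> P) (z : P) : 'M[R]_(c + u + s) :=
  \matrix_(i, j) derive (fun w => F w 0 j) z (evec i).
Definition dblk p q (F : P -> P) (z : P) (A : 'I_p -> 'I_(c + u + s))
  (B : 'I_q -> 'I_(c + u + s)) : 'M[R]_(p, q) := \matrix_(i, j) Jac F z (A i) (B j).

Definition supD (Rad : R) (e : P -> R) := sup [set e z | z in Dl Rad].
Definition infD (Rad : R) (e : P -> R) := inf [set e z | z in Dl Rad].
Definition Pz (Rad : R) (z : P) := [set w | Dl Rad w /\ enorm (lam w - lam z) <= RLam / 2].

Section Consts.
Variables (Rad L : R) (F : P -> P).
Let fyy z := dblk F z iY iY.
Let fy_lx z := dblk F z iLX iY.
Let flx_y z := dblk F z iY iLX.
Let fxx z := dblk F z iX iX.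
Let fx_ly z := dblk F z iLY iX.
Let fly_x z := dblk F z iX iLY.
Let fly_ly z := dblk F z iLY iLY.
Let flx_lx z := dblk F z iLX iLX.
Definition mu_s1 := supD Rad (fun z => opnorm (fyy z) + L^-1 * opnorm (fy_lx z)).
Definition mu_s2 := supD Rad (fun z => opnorm (fyy z) + L * opnorm (flx_y z)).
Definition xi_u1 := infD Rad (fun z => mlow (fxx z) - L^-1 * opnorm (fx_ly z)).
Definition xi_u1P := infD Rad (fun z => mset [set fxx w | w in Pz Rad z])
                     - L^-1 * supD Rad (fun z => opnorm (fx_ly z)).
Definition xi_u2 := infD Rad (fun z => mlow (fxx z) - L * opnorm (fly_x z)).
Definition mu_cs1 := supD Rad (fun z => opnorm (fly_ly z) + L * opnorm (fly_x z)).
Definition mu_cs2 := supD Rad (fun z => opnorm (fly_ly z) + L^-1 * opnorm (fx_ly z)).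
Definition xi_cu1 := infD Rad (fun z => mlow (flx_lx z) - L * opnorm (flx_y z)).
Definition xi_cu1P := infD Rad (fun z => mset [set flx_lx w | w in Pz Rad z])
                     - L * supD Rad (fun z => opnorm (flx_y z)).
Definition xi_cu2 := infD Rad (fun z => mlow (flx_lx z) - L^-1 * opnorm (fy_lx z)).

Definition xi_M (M : R) := infD Rad (fun z => mset [set flx_lx w | w in Pz Rad z])
                     - M * supD Rad (fun z => opnorm (flx_y z)).
Definition mu_M (M : R) := supD Rad (fun z => opnorm (fyy z) + M^-1 * opnorm (fy_lx z)).

Definition rate_conditions (k : nat) :=
  [/\ 0 < xi_u1, 0 < xi_u1P, 0 < xi_u2 & 0 < xi_cu1] /\ [/\ 0 < xi_cu1P & 0 < xi_cu2] /\
  [/\ mu_s1 < 1, 1 < xi_u1P, mu_cs1 < xi_u1P & mu_s1 < xi_cu1P] /\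
  [/\ (forall j : nat, (1 <= j <= k)%N ->
         mu_cs1 ^+ j.+1 < xi_u2 /\ mu_s2 < xi_cu1 ^+ j.+1),
      mu_cs2 < xi_u1 & mu_s1 < xi_cu2].
End Consts.

(* cones, via lifts in the same chart: w in J_s(z, M), w in J_u(z, M) *)
Definition inJs (M : R) (z w : P) :=
  exists n, intvec n /\
    enorm (row_mx (lam w + n - lam z) (xc w - xc z)) <= M * enorm (yc w - yc z).

Definition backward_cone (Rad L : R) (F : P -> P) :=
  forall z1 z2, Dl Rad z1 -> Dl Rad z2 -> Dl Rad (F z1) -> Dl Rad (F z2) ->
    inJs L^-1 (F z2) (F z1) -> inJs L^-1 z2 z1.

(* covering conditions; all sets are written in lifted coordinates:
   U = J_u(z,1/L) /\ D lifted around the lift z (these are the lifts within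
   the chart of z), D_{lambda*} and D^+_{lambda*} are subsets of the chart
   B_c(lambda*, R_Lambda) x R^u x R^s. *)
Definition Uset (Rad L : R) (z : P) : set P :=
  [set w | Dl Rad w /\ enorm (ly w - ly z) <= L^-1 * enorm (xc w - xc z)].
Definition covering (Rad L : R) (F : P -> P) :=
  forall z, Dl Rad z ->
  exists (lst : 'rV[R]_c) (h : R -> P -> P) (A : 'M[R]_u),
    let U := Uset Rad L z in
    [/\ {within [set p : R * P | 0 <= p.1 <= 1 /\ U p.2],
           continuous (fun p : R * P => h p.1 p.2)},
        (forall a w, 0 <= a <= 1 -> U w -> enorm (lam (h a w) - lst) < RLam),
        (forall w, U w -> equivP (h 0 w) (F w))
      & (forall w, U w -> h 1 w = mkpt lst (xc w *m A) 0)] /\ [/\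
        (forall a w, 0 <= a <= 1 -> U w ->
           enorm (lam w - lam z) <= RLam -> enorm (xc w) = Rad -> enorm (yc w) < Rad ->
           ~ [/\ enorm (lam (h a w) - lst) <= RLam, enorm (xc (h a w)) <= Rad
               & enorm (yc (h a w)) <= Rad]),
        (forall a w, 0 <= a <= 1 -> U w ->
           ~ [/\ enorm (lam (h a w) - lst) <= RLam, enorm (xc (h a w)) <= Rad
               & enorm (yc (h a w)) = Rad])
      & (forall x : 'rV[R]_u, enorm x = Rad -> Rad < enorm (x *m A))].

Definition Wcu (Rad : R) (F : P -> P) (z : P) :=
  exists zs : nat -> P, zs 0%N = z /\
    forall i, Dl Rad (zs i) /\ equivP (F (zs i.+1)) (zs i).
End Defs.

(* Main.v *)
(* No degree theory is needed: a point z1 of W^cu provides a nonempty intersection, and the rest is an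
   open-and-closed argument.  Call "center disk" an M-Lipschitz graph y = w(lambda, x) over the whole of
   Lambda x B_u(R).  If the image under f of a center disk G meets D, then f(G) /\ D is again a center
   disk: its projection to Lambda x B_u(R) is open because (lambda, x) |-> f_(lambda,x)(lambda, x, w) is
   a local homeomorphism (it expands by xi > 0 and, by the covering conditions, points of D mapped into D
   have |x| < R while their images have |y| < R), it is closed by compactness, the backward cone
   condition makes f(G) /\ D a graph, and xi > mu makes this graph locally, hence (by convexity)
   globally, M-Lipschitz.
   Starting with the flat disk through the n-th backward iterate of z1, n steps give a center disk G_n
   through z1.  The point of G_n above (lambda, x)(z2) and z2 itself have backward orbits of length n in D
   that stay in each other's stable cones, so they are at distance at most mu_{s,1}^n 2R.  Let n go to
   infinity. *)
Require Import Defs.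
From HB Require Import structures.
From mathcomp Require Import all_boot all_order all_algebra.
From mathcomp Require Import all_classical all_reals all_analysis.
From mathcomp Require Import ring lra.
Set Implicit Arguments. Unset Strict Implicit. Unset Printing Implicit Defensive.
Import Order.TTheory GRing.Theory Num.Theory.
Import numFieldNormedType.Exports.
Local Open Scope classical_set_scope.
Local Open Scope ring_scope.

(** * The Euclidean norm, the operator norm and the lower bound $m(A)$ *)

Section EuclideanNorm.
Variable R : realType.
Implicit Types p q : nat.

(** Cauchy-Schwarz by Lagrange's identity: the difference of the two sides is half the double sum of
    $(a_i b_j - a_j b_i)^2$. *)
Lemma sqr_sum_mul_le (I : finType) (a b : I -> R) :
  (\sum_i a i * b i) ^+ 2 <= (\sum_i a i ^+ 2) * (\sum_i b i ^+ 2).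
Proof.
rewrite -subr_ge0.
have -> : (\sum_i a i ^+ 2) * (\sum_i b i ^+ 2) - (\sum_i a i * b i) ^+ 2 =
    2^-1 * \sum_i \sum_j (a i * b j - a j * b i) ^+ 2.
  transitivity (2^-1 * (\sum_i \sum_j (a i ^+ 2 * b j ^+ 2)
      + \sum_i \sum_j (b i ^+ 2 * a j ^+ 2)
      - 2 * \sum_i \sum_j (a i * b i * (a j * b j)))).
    have bs (f g : I -> R) : (\sum_i f i) * (\sum_i g i) = \sum_i \sum_j f i * g j.
      by rewrite mulr_suml; apply: eq_bigr => i _; rewrite mulr_sumr.
    by rewrite -!bs expr2; field.
  congr (2^-1 * _); rewrite -big_split mulr_sumr -sumrB; apply: eq_bigr => i _ /=.
  rewrite -big_split mulr_sumr -sumrB; apply: eq_bigr => j _ /=; ring.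
by rewrite mulr_ge0 ?invr_ge0// sumr_ge0// => i _; rewrite sumr_ge0// => j _; rewrite sqr_ge0.
Qed.

Definition sqnorm p q (v : 'M[R]_(p, q)) : R := \sum_i \sum_j v i j ^+ 2.

Lemma sqnorm_ge0 p q (v : 'M[R]_(p, q)) : 0 <= sqnorm v.
Proof. by rewrite sumr_ge0// => i _; rewrite sumr_ge0// => j _; rewrite sqr_ge0. Qed.

Lemma enorm_ge0 p q (v : 'M[R]_(p, q)) : 0 <= enorm v.
Proof. exact: sqrtr_ge0. Qed.

Lemma enorm_sqr p q (v : 'M[R]_(p, q)) : enorm v ^+ 2 = sqnorm v.
Proof. by rewrite sqr_sqrtr// sqnorm_ge0. Qed.

Lemma enorm_leP p q p' q' (v : 'M[R]_(p, q)) (w : 'M[R]_(p', q')) :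
  (enorm v <= enorm w) = (sqnorm v <= sqnorm w).
Proof. by rewrite -!enorm_sqr ler_sqr// nnegrE enorm_ge0. Qed.

Lemma enormZ p q (k : R) (v : 'M[R]_(p, q)) : enorm (k *: v) = `|k| * enorm v.
Proof.
rewrite /enorm -[in RHS]sqrtr_sqr -sqrtrM ?sqr_ge0//; congr Num.sqrt.
rewrite mulr_sumr; apply: eq_bigr => i _; rewrite mulr_sumr; apply: eq_bigr => j _.
by rewrite mxE exprMn.
Qed.

Lemma enorm0 p q : enorm (0 : 'M[R]_(p, q)) = 0.
Proof. by rewrite -[0](scale0r 0) enormZ normr0 mul0r. Qed.

Lemma enormN p q (v : 'M[R]_(p, q)) : enorm (- v) = enorm v.
Proof. by rewrite -scaleN1r enormZ normrN1 mul1r. Qed.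

Lemma enormB p q (v w : 'M[R]_(p, q)) : enorm (v - w) = enorm (w - v).
Proof. by rewrite -opprB enormN. Qed.

Lemma enorm_eq0 p q (v : 'M[R]_(p, q)) : enorm v = 0 -> v = 0.
Proof.
move=> v0; have : sqnorm v = 0 by rewrite -enorm_sqr v0 expr0n.
move=> /psumr_eq0P E; apply/matrixP => i j; rewrite mxE.
have /psumr_eq0P E' := E (fun i _ => sumr_ge0 _ (fun j _ => sqr_ge0 _)) i isT.
by apply/eqP; rewrite -sqrf_eq0 E' // => k _; rewrite sqr_ge0.
Qed.

Lemma enorm_le0 p q (v : 'M[R]_(p, q)) : enorm v <= 0 -> v = 0.
Proof. by move=> v0; apply: enorm_eq0; apply/eqP; rewrite eq_le v0 enorm_ge0. Qed.

Lemma enormD p q (v w : 'M[R]_(p, q)) : enorm (v + w) <= enorm v + enorm w.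
Proof.
rewrite -(@ler_pXn2r _ 2)// ?nnegrE ?addr_ge0 ?enorm_ge0//.
rewrite sqrrD !enorm_sqr /sqnorm !pair_bigA /=.
under eq_bigr do rewrite mxE sqrrD.
rewrite !big_split /= lerD2r lerD2l. rewrite -mulr2n lerMn2r /=.
apply: le_trans (ler_norm _) _.
rewrite -(@ler_pXn2r _ 2)// ?nnegrE ?mulr_ge0 ?enorm_ge0//.
by rewrite real_normK ?num_real// exprMn !enorm_sqr /sqnorm !pair_bigA sqr_sum_mul_le.
Qed.

Lemma enormBD p q (v w : 'M[R]_(p, q)) : enorm (v - w) <= enorm v + enorm w.
Proof. by rewrite -(enormN w) enormD. Qed.

Lemma enorm_dist_triangle p q (v w x : 'M[R]_(p, q)) :
  enorm (v - x) <= enorm (v - w) + enorm (w - x).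
Proof. by rewrite -[v - x](subrKA w) enormD. Qed.

Lemma enorm_lowerD p q (v w : 'M[R]_(p, q)) : enorm v - enorm w <= enorm (v + w).
Proof. by rewrite lerBlDr -(enormN w) -{1}[v](addrK w) enormD. Qed.

Lemma enorm_sum p q (I : Type) (r : seq I) (P : pred I) (f : I -> 'M[R]_(p, q)) :
  enorm (\sum_(i <- r | P i) f i) <= \sum_(i <- r | P i) enorm (f i).
Proof.
elim/big_ind2: _ => [|x1 x2 y1 y2 h1 h2|//]; first by rewrite enorm0.
by rewrite (le_trans (enormD _ _))// lerD.
Qed.

Lemma enorm_delta p q i j : enorm (delta_mx i j : 'M[R]_(p, q)) = 1.
Proof.
rewrite /enorm (bigD1 i)//= (bigD1 j)//= big1 ?big1 ?addr0.
- by rewrite mxE !eqxx expr1n sqrtr1.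
- by move=> k /negbTE ki; rewrite big1 // => l _; rewrite mxE ki expr0n.
- by move=> l /negbTE lj; rewrite mxE lj andbF expr0n.
Qed.

Lemma enorm_le_sum p q (v : 'M[R]_(p, q)) : enorm v <= \sum_i \sum_j `|v i j|.
Proof.
rewrite {1}[v]matrix_sum_delta (le_trans (enorm_sum _ _ _))// ler_sum// => i _.
rewrite (le_trans (enorm_sum _ _ _))// ler_sum// => j _.
by rewrite enormZ enorm_delta mulr1.
Qed.

Lemma enorm_entry p q (v : 'M[R]_(p, q)) i j : `|v i j| <= enorm v.
Proof.
rewrite -sqrtr_sqr ler_sqrt ?sqnorm_ge0// (bigD1 i)//= (bigD1 j)//= -addrA lerDl.
by rewrite addr_ge0// sumr_ge0// => k _; rewrite ?sqr_ge0// sumr_ge0// => l _; rewrite sqr_ge0.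
Qed.

Lemma sqnorm_row_mx p (q1 q2 : nat) (a : 'M[R]_(p, q1)) (b : 'M[R]_(p, q2)) :
  sqnorm (row_mx a b) = sqnorm a + sqnorm b.
Proof.
rewrite /sqnorm -big_split; apply: eq_bigr => i _ /=; rewrite big_split_ord /=.
by congr (_ + _); apply: eq_bigr => j _; rewrite ?row_mxEl ?row_mxEr.
Qed.

Lemma enorm_lsubmx p (q1 q2 : nat) (v : 'M[R]_(p, q1 + q2)) : enorm (lsubmx v) <= enorm v.
Proof. by rewrite enorm_leP -{2}[v]hsubmxK sqnorm_row_mx lerDl sqnorm_ge0. Qed.

Lemma enorm_rsubmx p (q1 q2 : nat) (v : 'M[R]_(p, q1 + q2)) : enorm (rsubmx v) <= enorm v.
Proof. by rewrite enorm_leP -{2}[v]hsubmxK sqnorm_row_mx lerDr sqnorm_ge0. Qed.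

Lemma enorm_hsplit p (q1 q2 : nat) (v : 'M[R]_(p, q1 + q2)) :
  enorm v <= enorm (lsubmx v) + enorm (rsubmx v).
Proof.
rewrite -(@ler_pXn2r _ 2)// ?nnegrE ?addr_ge0 ?enorm_ge0//.
rewrite -{1}[v]hsubmxK sqrrD !enorm_sqr sqnorm_row_mx lerD2r lerDl.
by rewrite mulrn_wge0// mulr_ge0 ?enorm_ge0.
Qed.

Lemma enorm_mulmx_le_sum p q (v : 'rV[R]_p) (A : 'M[R]_(p, q)) :
  enorm v <= 1 -> enorm (v *m A) <= \sum_i \sum_j `|A i j|.
Proof.
move=> v1; rewrite mulmx_sum_row (le_trans (enorm_sum _ _ _))// ler_sum// => i _.
rewrite enormZ -[leRHS]mul1r ler_pM ?enorm_ge0//.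
  exact: le_trans (enorm_entry _ _ _) v1.
apply: le_trans (enorm_le_sum _) _; rewrite big_ord1.
by rewrite ler_sum// => j _; rewrite mxE.
Qed.

(** [sup] returns a default value on sets without an upper bound, so the entrywise bound is what
    makes [opnorm] a true supremum. *)
Lemma opnorm_has_sup p q (A : 'M[R]_(p, q)) :
  has_sup [set enorm (v *m A) | v in [set v : 'rV[R]_p | enorm v <= 1]].
Proof.
split; first by exists (enorm ((0 : 'rV[R]_p) *m A)), 0; rewrite //= enorm0.
by exists (\sum_i \sum_j `|A i j|) => _ [v /= v1 <-]; exact: enorm_mulmx_le_sum.
Qed.

Lemma opnorm_ge0 p q (A : 'M[R]_(p, q)) : 0 <= opnorm A.
Proof.
apply: (@le_trans _ _ (enorm ((0 : 'rV[R]_p) *m A))); first exact: enorm_ge0.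
by apply: sup_upper_bound; [exact: opnorm_has_sup|exists 0; rewrite //= enorm0].
Qed.

Lemma opnorm_le_sum p q (A : 'M[R]_(p, q)) : opnorm A <= \sum_i \sum_j `|A i j|.
Proof.
apply: ge_sup; first exact: (opnorm_has_sup A).1.
by move=> _ [v /= v1 <-]; exact: enorm_mulmx_le_sum.
Qed.

Lemma enorm_mulmx_le p q (v : 'rV[R]_p) (A : 'M[R]_(p, q)) :
  enorm (v *m A) <= opnorm A * enorm v.
Proof.
have [/enorm_eq0 ->|v0] := eqVneq (enorm v) 0.
  by rewrite mul0mx !enorm0 mulr0.
have vp : 0 < enorm v by rewrite lt_neqAle eq_sym v0 enorm_ge0.
rewrite -ler_pdivrMr// -{1}[v](scalerKV v0) -scalemxAl enormZ ger0_norm ?(ltW vp)//.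
rewrite mulrAC mulfV// mul1r; apply: (sup_upper_bound (opnorm_has_sup A)).
by exists ((enorm v)^-1 *: v) => //=; rewrite enormZ ger0_norm ?invr_ge0 ?(ltW vp)// mulVf.
Qed.

(** The constant 0 is always admissible. For $p = 0$ every constant is admissible, and the supremum
    is then the default 0. *)
Lemma mlow_ge0 p q (A : 'M[R]_(p, q)) : 0 <= mlow A.
Proof.
rewrite /mlow; set S := (X in sup X).
have S0 : S 0 by move=> v; rewrite mul0r enorm_ge0.
have [/asboolP hs|/asboolPn/sup_out ->//] := boolP `[< has_sup S >].
exact: sup_upper_bound.
Qed.

Lemma mlow_le p q (v : 'rV[R]_p) (A : 'M[R]_(p, q)) : mlow A * enorm v <= enorm (v *m A).
Proof.
have [/enorm_eq0 ->|v0] := eqVneq (enorm v) 0.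
  by rewrite mul0mx !enorm0 mulr0.
have vp : 0 < enorm v by rewrite lt_neqAle eq_sym v0 enorm_ge0.
rewrite -ler_pdivlMr//; apply: ge_sup; first by exists 0 => w; rewrite mul0r enorm_ge0.
by move=> k /= h; rewrite ler_pdivlMr.
Qed.

Lemma mlow_unitmx p (A : 'M[R]_p) : 0 < mlow A -> A \in unitmx.
Proof.
move=> A0; rewrite -row_free_unit; apply/inj_row_free => v vA.
apply: enorm_le0; have := mlow_le v A.
by rewrite vA enorm0 pmulr_rle0.
Qed.

End EuclideanNorm.

(** * Topology in terms of the Euclidean norm, fixed points and cluster points *)

Section EuclideanTopology.
Variable R : realType.

(** The topology on matrices comes from the entrywise maximum norm. Together with [enorm_le_mx_norm]
    this transfers neighbourhoods, continuity and compactness to the Euclidean norm. *)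
Lemma mx_norm_le_enorm p q (v : 'M[R]_(p, q)) : `|v| <= enorm v.
Proof. by rewrite [leLHS]/Num.norm /= mx_normrE; apply/bigmax_leP; split=> [|i _]; rewrite ?enorm_ge0 ?enorm_entry. Qed.

Lemma le_mx_norm p q (v : 'M[R]_(p, q)) i j : `|v i j| <= `|v|.
Proof. by rewrite [leRHS]/Num.norm /= mx_normrE; apply/bigmax_geP; right; exists (i, j). Qed.

Lemma enorm_le_mx_norm p q (v : 'M[R]_(p, q)) : enorm v <= (p * q)%:R * `|v|.
Proof.
apply: le_trans (enorm_le_sum v) _; rewrite pair_bigA /=.
apply: le_trans (ler_sum (G := fun=> `|v|) _ _) _; first by move=> i _; exact: le_mx_norm.
by rewrite sumr_const card_prod !card_ord mulr_natl.
Qed.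

Lemma nbhs_enorm p q (v : 'M[R]_(p, q)) (A : set 'M[R]_(p, q)) :
  nbhs v A -> exists2 d : R, 0 < d & forall w, enorm (w - v) < d -> A w.
Proof.
move=> /nbhs_ballP[d /= d0 dA]; exists d => // w wd; apply: dA.
rewrite -ball_normE /=; apply: le_lt_trans wd.
by rewrite -opprB normrN mx_norm_le_enorm.
Qed.

Lemma enorm_nbhs p q (v : 'M[R]_(p, q)) d :
  0 < d -> nbhs v [set w | enorm (w - v) < d].
Proof.
move=> d0; apply/nbhs_ballP; exists (d / (p * q).+1%:R) => /=; first by rewrite divr_gt0.
move=> w; rewrite -ball_normE /= => h.
apply: le_lt_trans (enorm_le_mx_norm _) _; rewrite -opprB normrN.
move: h; rewrite ltr_pdivlMr// mulrC; apply: le_lt_trans.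
by rewrite ler_wpM2r ?ler_nat.
Qed.

Lemma enorm_continuous p q (a : 'M[R]_(p, q)) :
  continuous ((fun v => enorm (v - a)) : 'M[R]_(p, q) -> R).
Proof.
move=> v; apply/(@cvgrPdist_lt _ _ _ (nbhs v) (nbhs_filter v)) => e e0.
apply: (@filterS _ (nbhs v) (nbhs_filter v) _ _ _ (enorm_nbhs v e0)) => w /= we.
apply: le_lt_trans we; rewrite ler_norml; apply/andP; split.
  by rewrite lerNl opprB lerBlDr (enorm_dist_triangle _ v).
by rewrite lerBlDr (enormB w v) enorm_dist_triangle.
Qed.

Lemma enorm_cvg_within n m (f : 'rV[R]_n -> 'rV[R]_m) (K : set 'rV[R]_n) (x : 'rV[R]_n) :
  (forall e : R, 0 < e -> exists2 d : R, 0 < d &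
    forall y, K y -> enorm (y - x) < d -> enorm (f y - f x) < e) ->
  f @ within K (nbhs x) --> f x.
Proof.
move=> h; apply/cvgrPdist_lt => e e0; have [d d0 dh] := h e e0.
rewrite near_withinE; apply: (@filterS _ (nbhs x) (nbhs_filter x) _ _ _ (enorm_nbhs x d0)) => y /= yd yK.
by rewrite -opprB normrN; apply: le_lt_trans (dh _ yK yd); exact: mx_norm_le_enorm.
Qed.

Lemma compact_eball n (a : 'rV[R]_n) r : compact [set x | enorm (x - a) <= r].
Proof.
apply: bounded_closed_compact; last first.
  rewrite (_ : mkset _ = (fun v => enorm (v - a)) @^-1` [set y | y <= r])//.
  by apply: closed_comp; [move=> x _; exact: enorm_continuous|exact: closed_le].
exists (r + enorm a); split; first by rewrite num_real.
move=> x rx v /= vr; apply: le_trans (mx_norm_le_enorm _) _; apply: le_trans (ltW rx).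
by rewrite -[v in leLHS](subrK a) (le_trans (enormD _ _))// lerD.
Qed.

(* The distance from x to T x attains its minimum on the compact ball; applying T to a minimizer shows
   that the minimum is 0. *)
Lemma eball_contraction_fixpoint n (a : 'rV[R]_n) (r k : R) (T : 'rV[R]_n -> 'rV[R]_n) :
  0 <= r -> k < 1 ->
  (forall x, enorm (x - a) <= r -> enorm (T x - a) <= r) ->
  (forall x y, enorm (x - a) <= r -> enorm (y - a) <= r ->
     enorm (T x - T y) <= k * enorm (x - y)) ->
  exists2 x, enorm (x - a) <= r & T x = x.
Proof.
move=> r0 k1 Tball Tk; set K := [set x | enorm (x - a) <= r].
have K0 : K !=set0 by exists a; rewrite /K /= subrr enorm0.
have cont : {within K, continuous (fun x => enorm (T x - x))}.
  apply/subspace_continuousP => x Kx.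
  have : (fun y => T y - y) @ within K (nbhs x) --> T x - x.
    apply: enorm_cvg_within => e e0; exists (e / 3); first by lra.
    move=> y Ky yx; have -> : T y - y - (T x - x) = (T y - T x) - (y - x).
      by rewrite !opprB addrACA [RHS]addrACA (addrC (- y)).
    have h := enormBD (T y - T x) (y - x).
    apply: le_lt_trans h _; have := Tk _ _ Ky Kx.
    have := enorm_ge0 (y - x); have : k * enorm (y - x) <= 1 * enorm (y - x).
      by rewrite ler_wpM2r ?enorm_ge0 ?ltW.
    lra.
  have e0 : continuous (@enorm R 1 n).
    have -> : @enorm R 1 n = fun v => enorm (v - 0) by apply/funext => v; rewrite subr0.
    exact: enorm_continuous.
  by move=> Tc; exact: continuous_cvg (e0 _) Tc.
have [x Kx xmin] := EVT_min_rV K0 (@compact_eball n a r) cont.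
rewrite inE in Kx; exists x => //; apply/eqP; rewrite -subr_eq0; apply/eqP/enorm_le0.
have KT := Tball _ Kx.
have := xmin (T x); rewrite inE => /(_ KT) h1; have h2 := Tk _ _ KT Kx.
rewrite leNgt; apply/negP => h0; have : k * enorm (T x - x) < 1 * enorm (T x - x).
  by rewrite ltr_pM2r.
lra.
Qed.

(** A cluster point, as $e \to 0^+$, of points of $K$ satisfying [A e]. If there were none, every
    $x$ in $K$ would have a neighbourhood on which [A i] fails for all small $i$; compactness makes
    one scale work for all of $K$, against the hypothesis. *)
Lemma compact_cluster_family n (K : set 'rV[R]_n) (A : R -> 'rV[R]_n -> Prop) :
  compact K -> (forall e : R, 0 < e -> exists q, K q /\ A e q) ->
  exists2 x, K x & forall e : R, 0 < e ->
    exists e' q, [/\ 0 < e' < e, K q, A e' q & enorm (q - x) < e].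
Proof.
move=> /compact_near_coveringP cK h; apply: contrapT => nh.
pose P i x := K x -> ~ A i x.
have /(cK R (0 : R)^'+ P _) Ksub : forall x, K x ->
    \forall x' \near x & i \near (0 : R)^'+, P i x'.
  move=> x Kx; have /existsNP[e /not_implyP[e0 eh]] :
      ~ forall e : R, 0 < e -> exists e' q, [/\ 0 < e' < e, K q, A e' q & enorm (q - x) < e].
    by move=> xh; apply: nh; exists x.
  exists ([set q | enorm (q - x) < e], [set i | 0 < i < e]) => /=.
    split; first exact: enorm_nbhs.
    by near=> t; apply/andP; split; near: t; [exact: nbhs_right_gt|exact: nbhs_right_lt].
  by move=> [q i] /= [qe ie] Kq Ai; apply: eh; exists i, q.
have [e [Ke e0]] : exists e, K `<=` P e /\ 0 < e.
  by apply: (@filter_ex _ (0 : R)^'+); exact: filterI Ksub (nbhs_right_gt (0 : R)).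
have [q [Kq Aq]] := h e e0.
exact: (Ke q Kq Kq Aq).
Unshelve. all: by end_near. Qed.

End EuclideanTopology.

(** * Induction on the unit interval, the mean value theorem along lines, strict
    differentiability *)

Section Calculus.
Variable R : realType.

(** Connectedness of $[0,1]$ through the supremum of the good parameters. As a supremum is
    approached from below, closedness is only asked for limits from the left. *)
Lemma unit_interval_induction (S : R -> Prop) :
  S 0 ->
  (forall t, 0 <= t < 1 -> S t -> exists2 t', t < t' <= 1 & S t') ->
  (forall t, 0 <= t <= 1 ->
     (forall e : R, 0 < e -> exists2 t', t - e < t' <= t & 0 <= t' /\ S t') -> S t) ->
  S 1.
Proof.
move=> S0 Sopen Sclosed; pose E := [set t | 0 <= t <= 1 /\ S t].
have E0 : E 0 by split=> //; rewrite lexx ler01.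
have hE : has_sup E by split; [exists 0|exists 1 => t [/andP[]]].
have t0 : 0 <= sup E by exact: sup_upper_bound.
have t1 : sup E <= 1 by apply: ge_sup; [exists 0|move=> t [/andP[]]].
have St : S (sup E).
  apply: Sclosed; first by rewrite t0.
  move=> e e0; have [t' [/andP[t'0 t'1] St'] et'] := sup_adherent e0 hE.
  exists t'; last by [].
  by rewrite et' sup_upper_bound//; split=> //; rewrite t'0.
have [->|t1'] := eqVneq 1 (sup E); first by [].
have [|t' /andP[tt' t'1] St'] := Sopen _ _ St.
  by rewrite t0 lt_neqAle eq_sym t1' t1.
suff : t' <= sup E by rewrite leNgt tt'.
apply: sup_upper_bound => //; split=> //.
by rewrite t'1 (le_trans t0 (ltW tt')).
Qed.

(** The estimate $\|f(t)-f(0)\| \le Kt$ propagates along $[0,1]$ by the triangle inequality. This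
    replaces integration of a derivative along a segment. *)
Lemma local_lipschitz_unit p q (f : R -> 'M[R]_(p, q)) (K : R) :
  (forall t, 0 <= t <= 1 -> exists2 d : R, 0 < d &
     forall t', 0 <= t' <= 1 -> `|t' - t| < d -> enorm (f t' - f t) <= K * `|t' - t|) ->
  enorm (f 1 - f 0) <= K.
Proof.
move=> h; rewrite -[K]mulr1.
apply: (@unit_interval_induction (fun t => enorm (f t - f 0) <= K * t)).
- by rewrite subrr enorm0 mulr0.
- move=> t /andP[t0 t1] St; have [|d d0 hd] := h t; first by rewrite t0 ltW.
  pose t' := Num.min 1 (t + d / 2).
  have tt' : t < t' by rewrite lt_min t1 ltrDl divr_gt0.
  have t'1 : t' <= 1 by rewrite ge_min lexx.
  have t'd : t' - t < d.
    have : t' <= t + d / 2 by rewrite ge_min lexx orbT.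
    lra.
  exists t'; first by rewrite tt'.
  have := hd t'; rewrite (le_trans t0 (ltW tt')) t'1 gtr0_norm ?subr_gt0// => /(_ isT t'd).
  have := enorm_dist_triangle (f t') (f t) (f 0); rewrite mulrBr; lra.
- move=> t t01 ht; have [d d0 hd] := h t t01.
  have [t' /andP[t't tt'] [t'0 St']] := ht d d0.
  have := hd t'; rewrite t'0 (le_trans tt') ?(andP t01).2//.
  rewrite distrC ger0_norm ?subr_ge0// ltrBlDr -ltrBlDl => /(_ isT t't).
  have := enorm_dist_triangle (f t) (f t') (f 0); rewrite (enormB (f t) (f t')) mulrBr; lra.
Qed.

Variable n : nat.
Implicit Types (g : 'rV[R]_n -> R) (w v q : 'rV[R]_n).

Lemma is_derive_line g w v (s : R) :
  derivable g (w + s *: v) v ->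
  is_derive s 1 (fun t => g (w + t *: v)) ('D_v g (w + s *: v)).
Proof.
move=> dg.
have E : (fun h : R => h^-1 *: (((fun t => g (w + t *: v)) \o shift s) (h *: (1 : R)) - g (w + s *: v)))
  = (fun h => h^-1 *: ((g \o shift (w + s *: v)) (h *: v) - g (w + s *: v))).
  by apply/funext => h /=; rewrite [h%:A]mulr1 scalerDl addrCA.
split; first by rewrite /derivable E.
by rewrite /derive E.
Qed.

Lemma line_MVT g w v (t : R) : 0 <= t ->
  (forall s, 0 <= s <= t -> derivable g (w + s *: v) v) ->
  exists2 s, 0 <= s <= t & g (w + t *: v) - g w = t * 'D_v g (w + s *: v).
Proof.
move=> t0 dg.
pose f : R -> R := fun t => g (w + t *: v); pose df : R -> R := fun s => 'D_v g (w + s *: v).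
have D (s : R) : s \in `[0, t] -> is_derive s 1 f (df s).
  by rewrite in_itv => st; apply: is_derive_line; apply: dg.
have D' (s : R) : s \in `]0, t[ -> is_derive s 1 f (df s).
  by move=> st; apply: D; exact: subset_itv_oo_cc.
have C : {within `[0, t], continuous f}.
  by apply: derivable_within_continuous => s /D ?; exact: ex_derive.
have [s st] := MVT_segment t0 D' C.
rewrite /f /df scale0r addr0 subr0 mulrC => ->; exists s => //.
Qed.

(** The mean value theorem for a step of either sign; a negative step is traversed backwards from
    its endpoint. [P] carries what is known about the segment over to the intermediate point. *)
Lemma line_MVT_abs g w v (t : R) (P : 'rV[R]_n -> Prop) :
  (forall s, `|s| <= `|t| -> 0 <= s * t -> P (w + s *: v)) ->
  (forall z, P z -> derivable g z v) ->
  exists2 z, P z & g (w + t *: v) - g w = t * 'D_v g z.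
Proof.
move=> hP dg; have [t0|t0] := leP 0 t.
  have [s /andP[s0 st]|s /andP[s0 st] ->] := @line_MVT g w v t t0.
    by apply/dg/hP; rewrite ?ger0_norm// mulr_ge0.
  by exists (w + s *: v) => //; apply: hP; rewrite ?ger0_norm// mulr_ge0.
have [|s /andP[s0 st]|s /andP[s0 st]] := @line_MVT g (w + t *: v) v (- t); first by lra.
  by rewrite -addrA -scalerDl; apply/dg/hP; [rewrite !ler0_norm; lra|nra].
rewrite -addrA -scalerDl subrr scale0r addr0 mulNr -addrA -scalerDl => /eqP.
rewrite -opprB eqr_opp => /eqP ->; exists (w + (t + s) *: v) => //.
by apply: hP; [rewrite !ler0_norm; lra|nra].
Qed.

(** Continuous partial derivatives give strict differentiability: both points vary, and the error is
    relative to their difference. One passes from [w2] to [w1] by changing one coordinate at a time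
    and applies the mean value theorem to each change. *)
Lemma strict_partial g (O : set 'rV[R]_n) q :
  nbhs q O ->
  (forall w (i : 'I_n), O w -> derivable g w (delta_mx 0 i)) ->
  (forall i : 'I_n, {for q, continuous (fun w => 'D_(delta_mx 0 i) g w)}) ->
  forall e : R, 0 < e -> exists2 d : R, 0 < d & forall w1 w2,
    enorm (w1 - q) < d -> enorm (w2 - q) < d ->
    `|g w1 - g w2 - \sum_i (w1 - w2) 0 i * 'D_(delta_mx 0 i) g q| <=
      e * \sum_i `|(w1 - w2) 0 i|.
Proof.
move=> qO dg cg e e0.
have : nbhs q [set z | O z /\ forall i : 'I_n,
    `|'D_(delta_mx 0 i) g z - 'D_(delta_mx 0 i) g q| <= e].
  apply: (filterI qO).
  have H (i : 'I_n) : nbhs q [set z | `|'D_(delta_mx 0 i) g z - 'D_(delta_mx 0 i) g q| <= e].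
    have /cvgrPdist_le/(_ e e0) := cg i.
    by apply: filterS => z /=; rewrite distrC.
  exact: (filter_forall (nbhs_filter q) H).
(* A ball of the maximum norm is a box, so it contains every point that mixes coordinates of [w1]
   and [w2]. *)
move=> /nbhs_ballP[d /= d0 hd]; exists d => // w1 w2 w1d w2d.
(* The $k$-th mixed point: the first $k$ coordinates come from [w1], the others from [w2]. *)
pose W k : 'rV[R]_n := \row_i (if (i < k)%N then w1 0 i else w2 0 i).
have Wn : W n = w1 by apply/rowP => i; rewrite mxE ltn_ord.
have W0 : W 0%N = w2 by apply/rowP => i; rewrite mxE.
have box (z : 'rV[R]_n) : (forall i : 'I_n, `|z 0 i - q 0 i| < d) -> ball q d z.
  move=> h; rewrite -ball_normE /= [ltLHS]/Num.norm /= mx_normrE.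
  apply/bigmax_ltP; split=> // -[i j] _ /=; rewrite !mxE (ord1 i) distrC; exact: h.
have in1 (i : 'I_n) : `|w1 0 i - q 0 i| < d.
  by have := enorm_entry (w1 - q) 0 i; rewrite !mxE => /le_lt_trans; exact.
have in2 (i : 'I_n) : `|w2 0 i - q 0 i| < d.
  by have := enorm_entry (w2 - q) 0 i; rewrite !mxE => /le_lt_trans; exact.
rewrite -{1}Wn -{1}W0.
suff H k : (k <= n)%N -> `|g (W k) - g (W 0%N) - \sum_(i < n | (i < k)%N) (w1 - w2) 0 i * 'D_(delta_mx 0 i) g q| <= e * \sum_(i < n | (i < k)%N) `|(w1 - w2) 0 i|.
  have bn (f : 'I_n -> R) : \sum_(i < n | (i < n)%N) f i = \sum_i f i.
    by apply: eq_bigl => i; rewrite ltn_ord.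
  by have := H n (leqnn n); rewrite !bn.
elim: k => [_|k IH kn].
  by rewrite subrr sub0r !big_pred0 ?oppr0 ?normr0 ?mulr0.
have := IH (ltnW kn); pose ik := Ordinal kn.
have bs (f : 'I_n -> R) : \sum_(i < n | (i < k.+1)%N) f i = f ik + \sum_(i < n | (i < k)%N) f i.
  rewrite (bigD1 ik)//=; congr (_ + _); apply: eq_bigl => i.
  by rewrite ltnS leq_eqVlt -val_eqE /=; case: ltngtP.
rewrite !bs.
have WS : W k.+1 = W k + (w1 - w2) 0 ik *: delta_mx 0 ik.
  apply/rowP => i; rewrite !mxE eqxx /= -val_eqE /= ltnS.
  case: ltngtP => ik'; rewrite ?mulr0 ?addr0//.
  have -> : i = ik by apply: val_inj.
  by rewrite mulr1 addrC subrK.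
have [s hs hs'|z [Oz _]|z [Oz zq] gE] := @line_MVT_abs g (W k) (delta_mx 0 ik) ((w1 - w2) 0 ik)
   (fun z => O z /\ forall i : 'I_n, `|'D_(delta_mx 0 i) g z - 'D_(delta_mx 0 i) g q| <= e).
- apply/hd/box => i; rewrite !mxE eqxx /= -val_eqE /=.
  have [ltik|gtik|eik] := ltngtP; rewrite ?mulr0 ?addr0 ?in1 ?in2//.
  have {eik} -> : i = ik by apply: val_inj.
  rewrite mulr1; move: hs hs' (in1 ik) (in2 ik); rewrite !mxE.
  (* The bounds on $s$ put $b+s$ between $a$ and $b$, both of which are within $d$ of $c$. *)
  move: (w1 0 ik) (w2 0 ik) (q 0 ik) => a b c h1 h2.
  rewrite !ltr_norml => /andP[h3 h4] /andP[h5 h6].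
  have [ab|ab] := lerP b a.
    move: h1; rewrite (ger0_norm (_ : 0 <= a - b)) ?subr_ge0// ler_norml => /andP[h7 h8].
    have : 0 <= s.
      have [ab'|] := eqVneq (a - b) 0; first by move: h7 h8; rewrite ab'; lra.
      move=> ab'; move: h2; rewrite pmulr_lge0// lt_neqAle eq_sym ab' subr_ge0//.
    by move=> s0; apply/andP; split; lra.
  move: h1; rewrite (ltr0_norm (_ : a - b < 0)) ?subr_lt0// ler_norml => /andP[h7 h8].
  have s0 : s <= 0 by move: h2; rewrite nmulr_lge0// subr_lt0.
  by apply/andP; split; lra.
- exact: dg.
move: gE; rewrite -WS => gE.
set A := \sum_(_ < _ | _) _; set B := \sum_(_ < _ | _) _; set x := (w1 - w2) 0 ik.
move=> IHk.
have -> : g (W k.+1) - g (W 0%N) - (x * 'D_(delta_mx 0 ik) g q + A) =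
   x * ('D_(delta_mx 0 ik) g z - 'D_(delta_mx 0 ik) g q) + (g (W k) - g (W 0%N) - A).
  by rewrite mulrBr -gE; ring.
rewrite [leRHS]mulrDr; apply: le_trans (ler_normD _ _) (lerD _ IHk).
by rewrite normrM mulrC ler_wpM2r.
Qed.

Lemma strict_diff m (F : 'rV[R]_n -> 'rV[R]_m) (O : set 'rV[R]_n) q :
  nbhs q O ->
  (forall w (i : 'I_n) (j : 'I_m), O w -> derivable (fun z => F z 0 j) w (delta_mx 0 i)) ->
  (forall (i : 'I_n) (j : 'I_m), {for q, continuous (fun w => 'D_(delta_mx 0 i) (fun z => F z 0 j) w)}) ->
  forall e : R, 0 < e -> exists2 d : R, 0 < d & forall w1 w2,
    enorm (w1 - q) < d -> enorm (w2 - q) < d ->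
    enorm (F w1 - F w2 -
      (w1 - w2) *m \matrix_(i, j) 'D_(delta_mx 0 i) (fun z => F z 0 j) q) <= e * enorm (w1 - w2).
Proof.
move=> qO dF cF e e0.
(* The error is summed over $m$ components and $n$ coordinates; the successor keeps the divisor
   nonzero. *)
pose e' := e / ((m * n).+1)%:R; have e'0 : 0 < e' by rewrite divr_gt0.
have /choice[d hd] j : exists d, 0 < d /\ forall w1 w2,
    enorm (w1 - q) < d -> enorm (w2 - q) < d ->
    `|F w1 0 j - F w2 0 j - \sum_i (w1 - w2) 0 i * 'D_(delta_mx 0 i) (fun z => F z 0 j) q| <=
      e' * \sum_i `|(w1 - w2) 0 i|.
  have [d d0 hd] := @strict_partial (fun z => F z 0 j) O q qO (fun w i => dF w i j) (fun i => cF i j) e' e'0.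
  by exists d.
exists (\big[Num.min/1]_j d j); first by apply: lt_bigmin => // j _; exact: (hd j).1.
move=> w1 w2 h1 h2; apply: le_trans (enorm_le_sum _) _; rewrite big_ord1.
apply: (@le_trans _ _ (\sum_(j < m) e' * (n%:R * enorm (w1 - w2)))).
  apply: ler_sum => j _; have := (hd j).2 w1 w2.
  have dj : \big[Num.min/1]_j d j <= d j by exact: bigmin_le_cond.
  move=> /(_ (lt_le_trans h1 dj) (lt_le_trans h2 dj)) h.
  have -> : (F w1 - F w2 - (w1 - w2) *m
      \matrix_(i, j) 'D_(delta_mx 0 i) (fun z => F z 0 j) q) 0 j =
    F w1 0 j - F w2 0 j - \sum_i (w1 - w2) 0 i * 'D_(delta_mx 0 i) (fun z => F z 0 j) q.
    by rewrite 3!mxE; congr (_ + _); rewrite 2!mxE; congr (- _); apply: eq_bigr => i _;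
      rewrite [X in _ * X]mxE.
  apply: le_trans h _; rewrite ler_wpM2l ?(ltW e'0)//.
  apply: (@le_trans _ _ (\sum_(i < n) enorm (w1 - w2))).
    by apply: ler_sum => i _; exact: enorm_entry.
  by rewrite sumr_const card_ord mulr_natl.
rewrite sumr_const card_ord; set E := enorm _.
have -> : e' * (n%:R * E) *+ m = e' * (m * n)%:R * E by rewrite -mulr_natr natrM; ring.
by rewrite ler_wpM2r ?enorm_ge0// /e' mulrAC ler_pdivrMr// ler_wpM2l ?ler_nat ?(ltW e0).
Qed.

End Calculus.

(** * Coordinates, integer translations and compactness in the lifted phase space *)

Section PhaseSpace.
Variables (R : realType) (c u s : nat).
Local Notation P := 'rV[R]_(c + u + s).
Implicit Types (p q z w : P) (n : 'rV[R]_c).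

Lemma lxB p q : lx (p - q) = lx p - lx q. Proof. exact: linearB. Qed.
Lemma lxD p q : lx (p + q) = lx p + lx q. Proof. exact: linearD. Qed.
Lemma ycB p q : yc (p - q) = yc p - yc q. Proof. exact: linearB. Qed.
Lemma ycD p q : yc (p + q) = yc p + yc q. Proof. exact: linearD. Qed.
Lemma xcB p q : xc (p - q) = xc p - xc q. Proof. by rewrite /xc !linearB. Qed.
Lemma xcD p q : xc (p + q) = xc p + xc q. Proof. by rewrite /xc !linearD. Qed.
Lemma lamB p q : lam (p - q) = lam p - lam q. Proof. by rewrite /lam !linearB. Qed.
Lemma lamD p q : lam (p + q) = lam p + lam q. Proof. by rewrite /lam !linearD. Qed.

Lemma xcZ a p : xc (a *: p) = a *: xc p. Proof. by rewrite /xc !linearZ. Qed.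
Lemma ycZ a p : yc (a *: p) = a *: yc p. Proof. exact: linearZ. Qed.

Lemma lx_mkpt (l : 'rV[R]_c) (x : 'rV[R]_u) (y : 'rV[R]_s) : lx (mkpt l x y) = row_mx l x.
Proof. exact: row_mxKl. Qed.
Lemma yc_mkpt (l : 'rV[R]_c) (x : 'rV[R]_u) (y : 'rV[R]_s) : yc (mkpt l x y) = y.
Proof. exact: row_mxKr. Qed.
Lemma xc_mkpt (l : 'rV[R]_c) (x : 'rV[R]_u) (y : 'rV[R]_s) : xc (mkpt l x y) = x.
Proof. by rewrite /xc /mkpt row_mxKl row_mxKr. Qed.
Lemma lam_mkpt (l : 'rV[R]_c) (x : 'rV[R]_u) (y : 'rV[R]_s) : lam (mkpt l x y) = l.
Proof. by rewrite /lam /mkpt !row_mxKl. Qed.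

Lemma lx_yc_inj p q : lx p = lx q -> yc p = yc q -> p = q.
Proof. by move=> h1 h2; rewrite -[p]hsubmxK -[q]hsubmxK; congr row_mx. Qed.

Lemma lx_lam_xc p : lx p = row_mx (lam p) (xc p).
Proof. by rewrite hsubmxK. Qed.

Lemma shiftD n1 n2 : Defs.shift u s (n1 + n2) = Defs.shift u s n1 + Defs.shift u s n2.
Proof. by rewrite /Defs.shift /mkpt !add_row_mx !addr0. Qed.
Lemma shiftN n : Defs.shift u s (- n) = - Defs.shift u s n.
Proof. by rewrite /Defs.shift /mkpt !opp_row_mx !oppr0. Qed.

Lemma xc_shift p n : xc (p + Defs.shift u s n) = xc p.
Proof. by rewrite xcD xc_mkpt addr0. Qed.
Lemma yc_shift p n : yc (p + Defs.shift u s n) = yc p.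
Proof. by rewrite ycD yc_mkpt addr0. Qed.
Lemma lam_shift p n : lam (p + Defs.shift u s n) = lam p + n.
Proof. by rewrite lamD lam_mkpt. Qed.

Lemma Dl_shift (Rad : R) p n : Dl Rad (p + Defs.shift u s n) <-> Dl Rad p.
Proof. by rewrite /Dl xc_shift yc_shift. Qed.

Lemma intvecN n : intvec n -> intvec (- n).
Proof. by move=> h i; rewrite mxE rpredN. Qed.
Lemma intvecD n1 n2 : intvec n1 -> intvec n2 -> intvec (n1 + n2).
Proof. by move=> h1 h2 i; rewrite mxE rpredD. Qed.

Lemma intvec_small n : intvec n -> enorm n < 1 -> n = 0.
Proof.
move=> ni n1; apply/rowP => i; rewrite mxE.
have := le_lt_trans (enorm_entry n 0 i) n1.
have /intrP[m ->] := ni i; rewrite -intr_norm -[1]/(1%:~R) ltr_int.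
by move=> h; suff -> : m = 0 by []; apply/eqP; rewrite -normr_le0 -ltzD1.
Qed.

(** The integer lattice is discrete: an integer vector within 1/2 of $n$ and a still closer one
    differ by less than 1, hence coincide, which is absurd unless the first one is $n$. *)
Lemma intvec_closed n :
  (forall e : R, 0 < e -> exists2 m, intvec m & enorm (m - n) < e) -> intvec n.
Proof.
move=> h; have [m mi mn] := h (1 / 2) ltac:(lra).
suff -> : n = m by [].
apply/eqP; rewrite -subr_eq0; apply/eqP/enorm_le0; rewrite leNgt; apply/negP => nm0.
have [|m' m'i m'n] := h (Num.min (1 / 2) (enorm (n - m))).
  by rewrite lt_min nm0 andbT; lra.
move: m'n; rewrite lt_min => /andP[m'n1 m'n2].
have /intvec_small/(_ _)/eqP : intvec (m' - m) by apply: intvecD => //; exact: intvecN.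
rewrite subr_eq0 => H.
have /eqP mm : m' == m.
  apply: H; have := enorm_dist_triangle m' n m; rewrite (enormB n m); lra.
by move: m'n2; rewrite mm enormB ltxx.
Qed.

Lemma equivP_sym p q : Defs.equivP p q -> Defs.equivP q p.
Proof.
move=> [n [ni ->]]; exists (- n); split; first exact: intvecN.
by rewrite shiftN addrK.
Qed.

Lemma equivP_trans q p z : Defs.equivP p q -> Defs.equivP q z -> Defs.equivP p z.
Proof.
move=> [n [ni ->]] [m [mi ->]]; exists (m + n); split; first exact: intvecD.
by rewrite shiftD addrA.
Qed.

Lemma equivP_shift p n : intvec n -> Defs.equivP (p + Defs.shift u s n) p.
Proof. by move=> ni; exists n. Qed.

Lemma equivP_Dl (Rad : R) p q : Defs.equivP p q -> Dl Rad q -> Dl Rad p.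
Proof. by move=> [n [_ ->]]; rewrite Dl_shift. Qed.

(** Subtracting the floors leaves entries in $[0,1)$. With [compact_fundamental] this substitutes
    for the compactness of $\Lambda$, as the lift of $D$ is unbounded. *)
Lemma fundamental_translate p :
  exists n, intvec n /\ enorm (lam (p + Defs.shift u s n)) <= c%:R.
Proof.
exists (\row_i - (Num.floor (lam p 0 i))%:~R); split.
  by move=> i; rewrite mxE rpredN rpred_int_num.
rewrite lam_shift; apply: le_trans (enorm_le_sum _) _; rewrite big_ord1.
apply: (@le_trans _ _ (\sum_(j < c) 1)); last by rewrite sumr_const card_ord.
apply: ler_sum => j _; rewrite mxE [X in _ + X]mxE.
have h1 := lt_succ_floor (lam p 0 j); have h2 := floor_le (lam p 0 j).
by rewrite intrD in h1; rewrite ger0_norm; lra.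
Qed.

Lemma enorm_lx_le p : enorm (lx p) <= enorm p. Proof. exact: enorm_lsubmx. Qed.
Lemma enorm_yc_le p : enorm (yc p) <= enorm p. Proof. exact: enorm_rsubmx. Qed.
Lemma enorm_xc_le p : enorm (xc p) <= enorm (lx p). Proof. exact: enorm_rsubmx. Qed.
Lemma enorm_lam_le p : enorm (lam p) <= enorm (lx p). Proof. exact: enorm_lsubmx. Qed.
Lemma enorm_lx_yc p : enorm p <= enorm (lx p) + enorm (yc p).
Proof. exact: enorm_hsplit. Qed.

Lemma closed_enorm_le m (f : P -> 'rV[R]_m) r :
  (forall p q, f (p - q) = f p - f q) -> (forall p, enorm (f p) <= enorm p) ->
  closed [set p | enorm (f p) <= r].
Proof.
move=> fB f1; rewrite (_ : mkset _ = (fun p => enorm (f p)) @^-1` [set y | y <= r])//.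
apply: closed_comp; last exact: closed_le.
move=> x _; apply/(@cvgrPdist_lt _ _ _ (nbhs x) (nbhs_filter x)) => e e0.
apply: (@filterS _ (nbhs x) (nbhs_filter x) _ _ _ (enorm_nbhs x e0)) => w /= we.
have h := le_lt_trans (f1 (w - x)) we; rewrite fB in h.
apply: le_lt_trans h; rewrite ler_norml; apply/andP; split.
  by rewrite lerNl opprB lerBlDr -{1}[f w](subrK (f x)) enormD.
by rewrite lerBlDr (enormB (f w)) -{1}[f x](subrK (f w)) enormD.
Qed.

Lemma compact_fundamental (Rad r : R) :
  compact [set p : P | Dl Rad p /\ enorm (lam p) <= r].
Proof.
apply: (subclosed_compact _ (@compact_eball R _ 0 (r + Rad + Rad))).
  rewrite (_ : mkset _ = [set p | enorm (xc p) <= Rad] `&` [set p | enorm (yc p) <= Rad]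
     `&` [set p | enorm (lam p) <= r]); last first.
    by apply/seteqP; split=> p /=; rewrite /Dl => -[[? ?] ?].
  apply: closedI; first apply: closedI.
  - apply: closed_enorm_le; first exact: xcB.
    by move=> p; exact: le_trans (enorm_xc_le p) (enorm_lx_le p).
  - by apply: closed_enorm_le; [exact: ycB|exact: enorm_yc_le].
  - apply: closed_enorm_le; first exact: lamB.
    by move=> p; exact: le_trans (enorm_lam_le p) (enorm_lx_le p).
move=> p /= [[xp yp] lp]; rewrite subr0.
apply: le_trans (enorm_lx_yc p) (lerD _ yp).
by apply: le_trans (enorm_hsplit (lx p)) (lerD _ _).
Qed.

End PhaseSpace.

(** * Strict differentiability of the lift on $D$, periodicity and boundedness of its Jacobian *)

Lemma subr_translate (V : zmodType) (a b x y : V) : a + x - (b + y) - (a - b) = x - y.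
Proof. by rewrite (opprD b y) addrACA (addrC (a - b)) addrK. Qed.

Lemma derive_translate (R : realType) (V : normedModType R) (g : V -> R) (a t v : V) (C : R) :
  'D_v (fun w => g (w - t) + C) (a + t) = 'D_v g a.
Proof.
rewrite /derive.
have E : (fun h : R => h^-1 *: (((fun w => g (w - t) + C) \o shift (a + t)) (h *: v)
     - (g (a + t - t) + C))) = (fun h => h^-1 *: ((g \o shift a) (h *: v) - g a)).
  apply/funext => h /=; rewrite addrK addrA addrK opprD addrACA subrr addr0 //.
by rewrite E.
Qed.

Section Jacobian.
Variables (R : realType) (c u s : nat).
Local Notation P := 'rV[R]_(c + u + s).
Variables (Rad : R) (F : P -> P) (r : nat).
Hypotheses (Rad0 : 0 < Rad) (r0 : (0 < r)%N).
Hypotheses (liftF : is_lift Rad F) (CF : Cr_map r Rad F).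
Implicit Types (p q z w : P) (n : 'rV[R]_c).

Lemma Jac_continuous q : Dl Rad q ->
  forall i j, {for q, continuous (fun w => Jac F w i j)}.
Proof.
move=> Dq i j; have [U [Uo [DU CU]]] := CF.
have [h _] := CU j [:: i] r0; move: h => /(_ _ (DU _ Dq)).
by rewrite (_ : (fun w => Jac F w i j) = 'D_(evec R i) (fun w => F w 0 j))//;
  apply/funext => w; rewrite mxE.
Qed.

Lemma strict_diff_Dl q : Dl Rad q -> forall e : R, 0 < e -> exists2 d : R, 0 < d &
  forall w1 w2, enorm (w1 - q) < d -> enorm (w2 - q) < d ->
    enorm (F w1 - F w2 - (w1 - w2) *m Jac F q) <= e * enorm (w1 - w2).
Proof.
move=> Dq; have [U [Uo [DU CU]]] := CF.
apply: (@strict_diff R _ _ F U q).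
- by apply: open_nbhs_nbhs; split=> //; exact: DU.
- by move=> w i j Uw; have [_ /(_ r0)] := CU j [::] isT; apply.
- move=> i j; have := @Jac_continuous q Dq i j.
  rewrite (_ : (fun w => Jac F w i j) = 'D_(evec R i) (fun w => F w 0 j))//.
  by apply/funext => w; rewrite mxE.
Qed.

Lemma continuous_Dl q : Dl Rad q -> forall e : R, 0 < e -> exists2 d : R, 0 < d &
  forall w, enorm (w - q) < d -> enorm (F w - F q) < e.
Proof.
move=> Dq e e0; have [d d0 hd] := strict_diff_Dl Dq ltr01.
pose C := 2 + opnorm (Jac F q); have C0 : 0 < C by have := opnorm_ge0 (Jac F q); rewrite /C; lra.
exists (Num.min d (e / C)); first by rewrite lt_min d0 divr_gt0.
move=> w; rewrite lt_min => /andP[wd we].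
have := hd w q wd; rewrite subrr enorm0 mul1r => /(_ d0) h.
have h2 := enorm_mulmx_le (w - q) (Jac F q).
have h3 : enorm (F w - F q) <= enorm (F w - F q - (w - q) *m Jac F q) + enorm ((w - q) *m Jac F q).
  by rewrite -{1}[F w - F q](subrK ((w - q) *m Jac F q)) enormD.
move: we; rewrite ltr_pdivlMr// mulrC /C !mulrDl; have := enorm_ge0 (w - q); lra.
Qed.

Lemma Dl_interior_near z : enorm (xc z) < Rad -> enorm (yc z) < Rad ->
  exists2 d : R, 0 < d & forall w, enorm (w - z) < d -> Dl Rad w.
Proof.
move=> xz yz; exists (Num.min (Rad - enorm (xc z)) (Rad - enorm (yc z))).
  by rewrite lt_min !subr_gt0 xz.
move=> w; rewrite lt_min => /andP[h1 h2]; split.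
  have := le_trans (enorm_xc_le (w - z)) (enorm_lx_le _); rewrite xcB.
  by have := enormD (xc w - xc z) (xc z); rewrite subrK; lra.
have := enorm_yc_le (w - z); rewrite ycB.
by have := enormD (yc w - yc z) (yc z); rewrite subrK; lra.
Qed.

(* The integer translation produced by the lift is locally constant by continuity. *)
Lemma Jac_shift z n : enorm (xc z) < Rad -> enorm (yc z) < Rad -> intvec n ->
  Jac F (z + Defs.shift u s n) = Jac F z.
Proof.
move=> xz yz ni; set t := Defs.shift u s n; have Dz : Dl Rad z by split; exact: ltW.
have Dzt : Dl Rad (z + t) by apply/Dl_shift.
have [m [mi mE]] := liftF Dz ni; rewrite -/t in mE.
(* The lift relation is given on $D$ only; for an interior point it holds on a full neighbourhood,
   as the comparison of derivatives requires. *)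
have [d1 d10 hd1] := Dl_interior_near xz yz.
(* Two increments of $F$ below 1/2 keep the integer vectors $m'$ and $m$ less than 1 apart, which
   forces them to be equal. *)
have [d2 d20 hd2] := continuous_Dl Dz (e := 1 / 2) ltac:(lra).
have [d3 d30 hd3] := continuous_Dl Dzt (e := 1 / 2) ltac:(lra).
have near w : enorm (w - (z + t)) < Num.min d1 (Num.min d2 d3) ->
    F w = F (w - t) + Defs.shift u s m.
  rewrite !lt_min => /and3P[w1 w2 w3].
  have wE : w - (z + t) = w - t - z by rewrite opprD addrA addrAC.
  have [m' [m'i m'E]] := liftF (hd1 (w - t) ltac:(by rewrite -wE)) ni.
  rewrite subrK in m'E; rewrite m'E.
  suff -> : m' = m by [].
  apply/eqP; rewrite -subr_eq0; apply/eqP/intvec_small.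
    by apply: intvecD => //; exact: intvecN.
  have -> : m' - m = lam ((F w - F (z + t)) - (F (w - t) - F z)).
    rewrite m'E mE; rewrite (_ : _ - _ = Defs.shift u s (m' - m)) ?lam_mkpt//.
    rewrite shiftD shiftN; move: (F (w - t)) (F z) => a b.
    by rewrite subr_translate.
  apply: le_lt_trans (le_trans (enorm_lam_le _) (enorm_lx_le _)) _.
  apply: le_lt_trans (enormBD _ _) _.
  have := hd3 w w3; have := hd2 (w - t); rewrite -wE => /(_ w2); lra.
apply/matrixP => i j; rewrite !mxE.
transitivity ('D_(evec R i) (fun w => F (w - t) 0 j + Defs.shift u s m 0 j) (z + t)).
  apply: near_eq_derive.
  have e0 : 0 < Num.min d1 (Num.min d2 d3) by rewrite !lt_min d10 d20.
  apply: (@filterS _ (nbhs (z + t)) (nbhs_filter _) _ _ _ (enorm_nbhs (z + t) e0)).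
  by move=> w /= /near ->; rewrite mxE.
exact: (derive_translate (fun w => F w 0 j)).
Qed.

(** Periodicity moves an interior point into a compact fundamental domain, on which each continuous
    entry attains a maximum. *)
Lemma Jac_bounded_interior : exists2 B : R, 0 <= B & forall z,
  enorm (xc z) < Rad -> enorm (yc z) < Rad -> forall i j, `|Jac F z i j| <= B.
Proof.
pose K := [set p : P | Dl Rad p /\ enorm (lam p) <= c%:R].
have K0 : K !=set0.
  exists 0; rewrite /K /Dl /= /lam /xc /yc !linear0 !enorm0 ler0n.
  by split=> //; split; exact: ltW.
have /choice[B hB] (ij : 'I_(c + u + s) * 'I_(c + u + s)) :
    exists b, forall z, K z -> `|Jac F z ij.1 ij.2| <= b.
  have [|z Kz zmax] := @EVT_max_rV R _ (fun z => `|Jac F z ij.1 ij.2|) K K0 (@compact_fundamental R c u s _ _).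
    apply/subspace_continuousP => z [Dz _].
    have /(@cvg_norm _ _ _ _ (nbhs_filter z)) h := @Jac_continuous z Dz ij.1 ij.2.
    by apply: cvg_within_filter.
  by exists `|Jac F z ij.1 ij.2| => w Kw; apply: zmax; rewrite inE.
exists (\sum_ij `|B ij|); first exact: sumr_ge0.
move=> z xz yz i j; have [n [ni nc]] := fundamental_translate z.
rewrite -(Jac_shift xz yz ni); apply: (@le_trans _ _ (B (i, j))).
  by apply: (hB (i, j)); split=> //; apply/Dl_shift; split; exact: ltW.
by rewrite (bigD1 (i, j))//= (le_trans (ler_norm _))// lerDl sumr_ge0.
Qed.

(** The interior bound passes to the boundary by continuity: shrinking $x$ and $y$ by the factor
    $1-t$ gives nearby interior points. *)
Lemma Jac_bounded : exists2 B : R, 0 <= B & forall z, Dl Rad z -> forall i j, `|Jac F z i j| <= B.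
Proof.
have [B B0 int] := Jac_bounded_interior; exists B => //.
move=> z Dz i j; rewrite leNgt; apply/negP => Bz.
have /cvgrPdist_lt/(_ (`|Jac F z i j| - B)) := @Jac_continuous z Dz i j.
rewrite subr_gt0 => /(_ Bz) /nbhs_enorm[d d0 hd].
(* The shrunk point is at distance at most $2tR < d$, and $t \le 1/2$ keeps the factor positive. *)
pose t := Num.min (1 / 2) (d / (2 * Rad + 1)).
have R1 : 0 < 2 * Rad + 1 by rewrite addr_gt0 ?mulr_gt0.
have t0 : 0 < t by rewrite lt_min; apply/andP; split; [lra|exact: divr_gt0].
have t1 : t <= 1 / 2 by rewrite ge_min lexx.
have td : t * (2 * Rad) < d.
  have : t <= d / (2 * Rad + 1) by rewrite ge_min lexx orbT.
  rewrite ler_pdivlMr; last lra.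
  by rewrite mulrDr mulr1; move: (t * (2 * Rad)) t0 => a; lra.
pose w : P := mkpt (lam z) ((1 - t) *: xc z) ((1 - t) *: yc z).
have wz : z - w = mkpt 0 (t *: xc z) (t *: yc z).
  apply: lx_yc_inj; rewrite ?lxB ?ycB ?lx_mkpt ?yc_mkpt ?lx_lam_xc.
    by rewrite opp_row_mx add_row_mx subrr scalerBl scale1r subKr.
  by rewrite scalerBl scale1r subKr.
case: Dz => xz yz.
have /hd : enorm (w - z) < d.
  rewrite enormB wz; apply: le_lt_trans td.
  apply: le_trans (enorm_lx_yc _) _; rewrite lx_mkpt yc_mkpt enormZ ger0_norm ?(ltW t0)//.
  apply: le_trans (lerD (enorm_hsplit _) (lexx _)) _.
  rewrite row_mxKl row_mxKr enorm0 enormZ ger0_norm ?(ltW t0)//.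
  rewrite add0r -mulrDr ler_wpM2l ?(ltW t0)//; lra.
have t10 : 0 <= 1 - t by lra.
have scaled a : a <= Rad -> (1 - t) * a < Rad.
  move=> aR; apply: le_lt_trans (ler_wpM2l t10 aR) _.
  by rewrite mulrBl mul1r gtrBl mulr_gt0.
have xw : enorm (xc w) < Rad by rewrite xc_mkpt enormZ ger0_norm// scaled.
have yw : enorm (yc w) < Rad by rewrite yc_mkpt enormZ ger0_norm// scaled.
move=> h2; have h1 := int w xw yw i j.
have := ler_distD (Jac F w i j) (Jac F z i j) 0.
rewrite !subr0; lra.
Qed.

End Jacobian.

(** * Pointwise estimates extracted from the rate constants *)

(** A matrix of $S$ belongs to the interval hull of $S$, provided that the entrywise infima and
    suprema are genuine; the uniform entry bound ensures this. *)
Lemma mset_le_mlow (R : realType) p q (S : set 'M[R]_(p, q)) (A : 'M[R]_(p, q)) (B : R) :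
  S A -> (forall X, S X -> forall i j, `|X i j| <= B) -> Defs.mset S <= mlow A.
Proof.
move=> SA SB; apply: ge_inf; first by exists 0 => _ [X _ <-]; exact: mlow_ge0.
exists A => // i j; split.
  apply: ge_inf; last by exists A.
  by exists (- B) => _ [X /SB/(_ i j) + <-]; rewrite ler_norml => /andP[].
apply: sup_upper_bound; last by exists A.
split; first by exists (A i j), A.
by exists B => _ [X /SB/(_ i j) + <-]; rewrite ler_norml => /andP[].
Qed.

Lemma mset_ge0 (R : realType) p q (S : set 'M[R]_(p, q)) : 0 <= Defs.mset S.
Proof.
rewrite /Defs.mset; set E := (X in inf X).
have [->|/set0P E0] := eqVneq E set0; first by rewrite inf0.
by apply: lb_le_inf => // _ [X _ <-]; exact: mlow_ge0.
Qed.

Section Rates.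
Variables (R : realType) (c u s : nat).
Local Notation P := 'rV[R]_(c + u + s).
Variables (Rad : R) (F : P -> P) (r : nat).
Hypotheses (Rad0 : 0 < Rad) (r0 : (0 < r)%N).
Hypotheses (liftF : is_lift Rad F) (CF : Cr_map r Rad F).
Implicit Types (p q z w v : P).

Local Notation flx_lx z := (dblk F z (iLX s) (iLX s)).
Local Notation flx_y z := (dblk F z (@iY c u s) (iLX s)).
Local Notation fy_lx z := (dblk F z (iLX s) (@iY c u s)).
Local Notation fyy z := (dblk F z (@iY c u s) (@iY c u s)).

(** Vectors are rows and the Jacobian acts from the right, so the block from $y$ to $(\lambda,x)$ is
    the lower left one. *)
Lemma mulmx_JacE v z : v *m Jac F z =
  row_mx (lx v *m flx_lx z + yc v *m flx_y z) (lx v *m fy_lx z + yc v *m fyy z).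
Proof.
rewrite -{1}[v]hsubmxK -[Jac F z]submxK mul_row_block.
by congr (row_mx (_ + _) (_ + _)); congr (_ *m _); apply/matrixP => i j; rewrite !mxE.
Qed.

Lemma opnorm_dblk_bounded m1 m2 (A : 'I_m1 -> 'I_(c + u + s)) (B : 'I_m2 -> 'I_(c + u + s)) :
  exists2 b : R, 0 <= b & forall z, Dl Rad z -> opnorm (dblk F z A B) <= b.
Proof.
have [b b0 hb] := Jac_bounded Rad0 r0 liftF CF.
exists (\sum_(i < m1) \sum_(j < m2) b); first by rewrite !sumr_ge0// => i _; rewrite sumr_ge0.
move=> z Dz; apply: le_trans (opnorm_le_sum _) _.
by apply: ler_sum => i _; apply: ler_sum => j _; rewrite mxE; exact: hb.
Qed.

(** The bounded Jacobian makes the supremum genuine. With $M$ in place of $L$ the constant [mu_s1]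
    is [mu_M] by conversion, so the same bound serves for $\mu$. *)
Lemma mu_s1_ge L z : 0 < L -> Dl Rad z ->
  opnorm (fyy z) + L^-1 * opnorm (fy_lx z) <= mu_s1 Rad L F.
Proof.
move=> L0 Dz; apply: sup_upper_bound; last by exists z.
split; first by eexists; exists z.
have [a a0 ha] := opnorm_dblk_bounded (@iY c u s) (@iY c u s).
have [b b0 hb] := opnorm_dblk_bounded (iLX s) (@iY c u s).
exists (a + L^-1 * b) => _ [w Dw <-].
by rewrite lerD ?ha// ler_wpM2l ?hb// invr_ge0 ltW.
Qed.

(** As $z \in P(z)$, the Jacobian block at $z$ lies in the interval hull over $P(z)$; hence the hull
    version of $m$ is below the value at $z$. *)
Lemma xi_M_le M z : 0 < M -> Dl Rad z ->
  xi_M Rad F M <= mlow (flx_lx z) - M * opnorm (flx_y z).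
Proof.
move=> M0 Dz; rewrite /xi_M lerB//; last first.
  rewrite ler_wpM2l ?(ltW M0)//; apply: sup_upper_bound; last by exists z.
  split; first by eexists; exists z.
  have [a a0 ha] := opnorm_dblk_bounded (@iY c u s) (iLX s).
  by exists a => _ [w Dw <-]; exact: ha.
have [b b0 hb] := Jac_bounded Rad0 r0 liftF CF.
apply: le_trans (_ : Defs.mset [set flx_lx w | w in Pz Rad z] <= _).
  apply: ge_inf; last by exists z.
  by exists 0 => _ [w _ <-]; exact: mset_ge0.
apply: (mset_le_mlow (B := b)).
  by exists z => //; split=> //; rewrite subrr enorm0 /RLam divr_ge0 ?invr_ge0.
by move=> _ [w [Dw _] <-] i j; rewrite mxE; exact: hb.
Qed.

Lemma mu_M_ge0 M : 0 < M -> 0 <= mu_M Rad F M.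
Proof.
move=> M0; have D0 : Dl Rad (0 : P).
  by rewrite /Dl /xc /yc !linear0 !enorm0; split; exact: ltW.
by apply: le_trans (mu_s1_ge M0 D0); rewrite addr_ge0 ?mulr_ge0 ?invr_ge0 ?opnorm_ge0 ?(ltW M0).
Qed.

Lemma Dl_segment q q' t : 0 <= t <= 1 -> Dl Rad q -> Dl Rad q' -> Dl Rad (q' + t *: (q - q')).
Proof.
move=> /andP[t0 t1] [xq yq] [xq' yq'].
have E m (a b : 'rV[R]_m) : enorm a <= Rad -> enorm b <= Rad ->
    enorm (b + t *: (a - b)) <= Rad.
  move=> aR bR; have -> : b + t *: (a - b) = (1 - t) *: b + t *: a.
    by rewrite scalerBr scalerBl scale1r addrA addrAC.
  apply: le_trans (enormD _ _) _; rewrite !enormZ !ger0_norm ?subr_ge0//.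
  have -> : Rad = (1 - t) * Rad + t * Rad by ring.
  rewrite lerD// ler_wpM2l ?subr_ge0//.
by split; rewrite ?xcD ?ycD ?xcZ ?ycZ ?xcB ?ycB; exact: E.
Qed.

(* Differentiate along the segment from q' to q, which stays in the (fibrewise convex) set D. *)
Lemma stable_cone_contraction L q q' : 0 < L -> Dl Rad q -> Dl Rad q' ->
  enorm (lx q - lx q') <= L^-1 * enorm (yc q - yc q') ->
  enorm (yc (F q) - yc (F q')) <= mu_s1 Rad L F * enorm (yc q - yc q').
Proof.
move=> L0 Dq Dq' cone; apply/ler_addgt0Pr => e e0.
(* With this linearization error, the total error over the whole segment is at most $e$. *)
pose e' := e / (enorm (q - q') + 1).
have d1 : 0 < enorm (q - q') + 1 by rewrite ltr_wpDl ?enorm_ge0.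
have e'0 : 0 < e' by rewrite divr_gt0.
have e'd : e' * enorm (q - q') <= e.
  by rewrite /e' mulrAC ler_pdivrMr// ler_wpM2l ?(ltW e0)// lerDl.
pose f (t : R) := yc (F (q' + t *: (q - q'))).
have -> : yc (F q) - yc (F q') = f 1 - f 0 by rewrite /f scale1r scale0r addr0 (addrC q') subrK.
apply: (@le_trans _ _ (mu_s1 Rad L F * enorm (yc q - yc q') + e' * enorm (q - q'))); last by rewrite lerD2l.
apply: local_lipschitz_unit => t t01.
have Dt := Dl_segment t01 Dq Dq'.
have [d d0 hd] := strict_diff_Dl r0 CF Dt e'0.
exists (d / (enorm (q - q') + 1)); first by rewrite divr_gt0.
move=> t' t'01 tt'; set wt := q' + t *: (q - q').
have wE : q' + t' *: (q - q') - wt = (t' - t) *: (q - q').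
  by rewrite /wt opprD addrACA subrr add0r scalerBl.
have wn : enorm (q' + t' *: (q - q') - wt) = `|t' - t| * enorm (q - q') by rewrite wE enormZ.
have := hd (q' + t' *: (q - q')) wt; rewrite subrr enorm0 wn => /(_ _ d0) h.
have {}h : enorm (F (q' + t' *: (q - q')) - F wt - (t' - t) *: (q - q') *m Jac F wt)
    <= e' * (`|t' - t| * enorm (q - q')).
  rewrite -wE; apply: h; move: tt'; rewrite ltr_pdivlMr//; apply: le_lt_trans.
  by rewrite ler_wpM2l ?normr_ge0// lerDl.
have {}h := le_trans (enorm_yc_le _) h.
rewrite ycB ycB -scalemxAl mulmx_JacE in h.
have yE : yc ((t' - t) *: row_mx (lx (q - q') *m flx_lx wt + yc (q - q') *m flx_y wt)
    (lx (q - q') *m fy_lx wt + yc (q - q') *m fyy wt)) =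
    (t' - t) *: (lx (q - q') *m fy_lx wt + yc (q - q') *m fyy wt).
  by rewrite ycZ /yc row_mxKr.
rewrite yE in h; rewrite /f -/wt.
have mu := mu_s1_ge L0 Dt; rewrite -/wt in mu.
(* The cone hypothesis replaces the $(\lambda,x)$ increment by $1/L$ times the $y$ increment, which
   produces exactly the expression bounded by [mu_s1]. *)
have h2 : enorm (lx (q - q') *m fy_lx wt + yc (q - q') *m fyy wt) <=
    mu_s1 Rad L F * enorm (yc q - yc q').
  apply: le_trans (enormD _ _) _; apply: le_trans (lerD (enorm_mulmx_le _ _) (enorm_mulmx_le _ _)) _.
  rewrite lxB ycB addrC.
  apply: le_trans (_ : (opnorm (fyy wt) + L^-1 * opnorm (fy_lx wt)) * enorm (yc q - yc q') <= _).
    by rewrite mulrDl lerD2l -mulrA mulrCA ler_wpM2l ?opnorm_ge0.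
  by rewrite ler_wpM2r ?enorm_ge0.
have := enormD (yc (F (q' + t' *: (q - q'))) - yc (F wt)
  - (t' - t) *: (lx (q - q') *m fy_lx wt + yc (q - q') *m fyy wt))
  ((t' - t) *: (lx (q - q') *m fy_lx wt + yc (q - q') *m fyy wt)).
rewrite subrK enormZ => h3; apply: le_trans h3 _.
rewrite mulrDl addrC lerD//; first by rewrite mulrC ler_wpM2r.
by rewrite -mulrA [_ * `|_|]mulrC.
Qed.

End Rates.

(** * The graph transform: images of center disks are center disks *)

Lemma enorm_sub_absorb (R : realType) p q (x v y : 'M[R]_(p, q)) :
  enorm (x - v) <= enorm (v - (x + y)) + enorm y.
Proof.
rewrite (enormB v); have -> : x - v = (x + y - v) - y by rewrite addrAC addrK.
exact: enormBD.
Qed.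

Section GraphTransform.
Variables (R : realType) (c u s : nat).
Local Notation P := 'rV[R]_(c + u + s).
Variables (Rad L M xi mu : R) (F : P -> P) (r : nat).
Hypotheses (Rad0 : 0 < Rad) (r0 : (0 < r)%N) (M0 : 0 < M) (ML : M < L).
Hypotheses (liftF : is_lift Rad F) (CF : Cr_map r Rad F) (bcF : backward_cone Rad L F).
Hypothesis exitF : forall q, Dl Rad q -> enorm (xc q) = Rad -> enorm (yc q) < Rad ->
  ~ Dl Rad (F q).
Hypothesis entryF : forall q, Dl Rad q -> Dl Rad (F q) -> enorm (yc (F q)) < Rad.
Hypotheses (mu0 : 0 <= mu) (muxi : mu < xi).
Hypothesis xiF : forall q, Dl Rad q ->
  xi <= mlow (dblk F q (iLX s) (iLX s)) - M * opnorm (dblk F q (@iY c u s) (iLX s)).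
Hypothesis muF : forall q, Dl Rad q ->
  opnorm (dblk F q (@iY c u s) (@iY c u s)) + M^-1 * opnorm (dblk F q (iLX s) (@iY c u s)) <= mu.
Implicit Types (p q z w v : P) (G : P -> Prop) (n : 'rV[R]_c).

(** The graph is encoded as a translation-invariant set of lifts. The Lipschitz clause makes it
    single-valued, and the last clause makes it total. The strict bound on $y$ is what allows
    [exitF] to be applied at its points. *)
Definition center_disk G :=
  [/\ forall p, G p -> enorm (xc p) <= Rad /\ enorm (yc p) < Rad,
      forall p n, G p -> intvec n -> G (p + Defs.shift u s n),
      forall p q, G p -> G q -> enorm (yc p - yc q) <= M * enorm (lx p - lx q)
    & forall a : 'rV[R]_(c + u), enorm (rsubmx a) <= Rad -> exists2 p, G p & lx p = a].

Definition disk_image G p := Dl Rad p /\ exists2 q, G q & Defs.equivP (F q) p.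

Lemma center_disk_Dl G p : center_disk G -> G p -> Dl Rad p.
Proof. by move=> [GD _ _ _] /GD[px py]; split=> //; exact: ltW. Qed.

Lemma center_disk_eq G p q : center_disk G -> G p -> G q -> lx p = lx q -> p = q.
Proof.
move=> [_ _ GL _] Gp Gq pq; apply: lx_yc_inj => //.
apply/eqP; rewrite -subr_eq0; apply/eqP/enorm_le0.
by have := GL p q Gp Gq; rewrite pq subrr enorm0 mulr0.
Qed.

Lemma disk_image_yc G p : center_disk G -> disk_image G p -> enorm (yc p) < Rad.
Proof.
move=> GD [Dp [q Gq [n [ni Fq]]]].
have := entryF (center_disk_Dl GD Gq); rewrite Fq yc_shift; apply.
exact/Dl_shift.
Qed.

(* Lipschitz inverse function theorem on the disk: lx (F (w a)) = b is solved by the contraction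
   a |-> a + (b - lx (F (w a))) A^-1, whose rate k uses xi_M > 0.  The margin eta for the linearization
   error is small enough for this (eta < xi) and for preserving the M-cone (eta (1 + M) <= M (xi - mu)). *)
Lemma disk_image_local G q : center_disk G -> G q -> Dl Rad (F q) ->
  exists2 d : R, 0 < d & forall b, enorm (b - lx (F q)) < d ->
    exists q', [/\ G q', lx (F q') = b &
      enorm (yc (F q') - yc (F q)) <= M * enorm (b - lx (F q))].
Proof.
move=> GD Gq DFq; have Dq := center_disk_Dl GD Gq.
case: (GD) => Gdom _ Glip Gtot.
(* The exit condition places $q$ in the open $x$-ball, so the disk is defined over a full ball
   around [lx q]. *)
have xq : enorm (xc q) < Rad.
  have [xq yq] := Gdom _ Gq; rewrite lt_neqAle xq andbT; apply/eqP => xqR.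
  exact: exitF xqR yq DFq.
pose A := dblk F q (iLX s) (iLX s).
pose B := dblk F q (@iY c u s) (iLX s).
have xi0 : 0 < xi by exact: le_lt_trans muxi.
have M1 : 0 < 1 + M by rewrite addr_gt0.
have hxi : xi + M * opnorm B <= mlow (dblk F q (iLX s) (iLX s)).
  by rewrite -lerBrDr; exact: xiF.
rewrite -/A in hxi; set m := mlow A in hxi.
have o0 : 0 <= M * opnorm B by rewrite mulr_ge0 ?opnorm_ge0 ?(ltW M0).
have m0 : 0 < m by apply: lt_le_trans hxi; rewrite ltr_wpDr.
have Au : A \in unitmx by exact: mlow_unitmx.
have Ainv (v : 'rV_(c + u)) : enorm (v *m invmx A) <= m^-1 * enorm v.
  by rewrite ler_pdivlMl// (le_trans (mlow_le _ _))// mulmxKV.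
pose eta := M * (xi - mu) / (1 + M) / 2.
have eta0 : 0 < eta by rewrite !divr_gt0// mulr_gt0// subr_gt0.
have eta1 : eta * (1 + M) <= M * (xi - mu).
  have -> : eta * (1 + M) = M * (xi - mu) / 2.
    by rewrite /eta mulrAC divfK// gt_eqF.
  by rewrite ler_pdivrMr// ler_peMr ?ler1n// mulr_ge0 ?subr_ge0 ?(ltW M0) ?(ltW muxi).
have eta2 : eta < xi.
  rewrite -(ltr_pM2r M1); apply: le_lt_trans eta1 _.
  rewrite mulrBr mulrDr mulr1 [xi * M]mulrC.
  apply: (@le_lt_trans _ _ (M * xi)); last by rewrite ltrDr.
  by rewrite gerBl mulr_ge0 ?(ltW M0).
(* A base displacement moves the point of the graph by at most $1+M$ times as much, so the
   linearization error becomes [eta] per unit of base displacement. *)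
pose e := eta / (1 + M); have e0 : 0 < e by rewrite divr_gt0.
pose k := (M * opnorm B + eta) / m.
have km : k * m = M * opnorm B + eta by rewrite /k divfK// gt_eqF.
have k1 : k < 1.
  rewrite /k ltr_pdivrMr// mul1r; apply: lt_le_trans hxi.
  by rewrite addrC ltrD2r.
have k0 : 0 <= k by rewrite divr_ge0 ?addr_ge0 ?(ltW eta0) ?(ltW m0).
have [d d0 hd] := strict_diff_Dl r0 CF Dq e0.
(* The first bound keeps base points over the $x$-ball; the second keeps the graph points within $d$
   of $q$. *)
pose rr := Num.min (Rad - enorm (xc q)) (d / (2 * (1 + M))).
have rr0 : 0 < rr.
  by rewrite lt_min subr_gt0 xq divr_gt0// mulr_gt0.
have rr1 : rr <= Rad - enorm (xc q) by rewrite ge_min lexx.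
have rr2 : (1 + M) * rr < d.
  have : rr <= d / (2 * (1 + M)) by rewrite ge_min lexx orbT.
  rewrite ler_pdivlMr ?mulr_gt0// => h; have : 0 < (1 + M) * rr by rewrite mulr_gt0.
  have E : rr * (2 * (1 + M)) = 2 * ((1 + M) * rr) by ring.
  by rewrite E in h; move: ((1 + M) * rr) h => x; lra.
have /choice[w hw] (a : 'rV[R]_(c + u)) :
    exists p, enorm (rsubmx a) <= Rad -> G p /\ lx p = a.
  have [/Gtot[p Gp pa]|h] := pselect (enorm (rsubmx a) <= Rad); first by exists p.
  by exists 0 => /h.
have inG a : enorm (a - lx q) <= rr -> G (w a) /\ lx (w a) = a.
  move=> ar; apply: hw; have := enorm_rsubmx (a - lx q); rewrite linearB /= => h1.
  have := enormD (rsubmx a - xc q) (xc q); rewrite subrK => h2.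
  apply: le_trans h2 _; rewrite -lerBrDr; apply: le_trans rr1; exact: le_trans ar.
have wlip a a' : enorm (a - lx q) <= rr -> enorm (a' - lx q) <= rr ->
    enorm (yc (w a) - yc (w a')) <= M * enorm (a - a') /\
    enorm (w a - w a') <= (1 + M) * enorm (a - a').
  move=> /inG[G1 l1] /inG[G2 l2]; have := Glip _ _ G1 G2; rewrite l1 l2 => h; split=> //.
  by apply: le_trans (enorm_lx_yc _) _; rewrite lxB ycB l1 l2 mulrDl mul1r lerD2l.
have a0r : enorm (lx q - lx q) <= rr by rewrite subrr enorm0 (ltW rr0).
have wq : w (lx q) = q by have [G1 l1] := inG _ a0r; exact: center_disk_eq GD G1 Gq l1.
have wd a : enorm (a - lx q) <= rr -> enorm (w a - q) < d.
  move=> ar; have [_] := wlip _ _ ar a0r; rewrite wq => /le_lt_trans; apply.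
  by apply: le_lt_trans rr2; rewrite ler_wpM2l ?(ltW M1).
have lin a a' : enorm (a - lx q) <= rr -> enorm (a' - lx q) <= rr ->
    enorm (F (w a) - F (w a') - (w a - w a') *m Jac F q) <= eta * enorm (a - a').
  move=> h1 h2; apply: le_trans (hd _ _ (wd _ h1) (wd _ h2)) _.
  have [_ h3] := wlip _ _ h1 h2.
  apply: le_trans (ler_wpM2l (ltW e0) h3) _.
  by rewrite mulrA /e divfK// gt_eqF.
have linx a a' : enorm (a - lx q) <= rr -> enorm (a' - lx q) <= rr ->
    enorm ((a - a') *m A - (lx (F (w a)) - lx (F (w a')))) <= (M * opnorm B + eta) * enorm (a - a').
  move=> h1 h2; have := le_trans (enorm_lx_le _) (lin _ _ h1 h2).
  rewrite lxB mulmx_JacE [lx (row_mx _ _)]row_mxKl !lxB (inG _ h1).2 (inG _ h2).2 ycB => h3.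
  have [h4 _] := wlip _ _ h1 h2.
  have h5 : enorm ((yc (w a) - yc (w a')) *m B) <= M * opnorm B * enorm (a - a').
    apply: le_trans (enorm_mulmx_le _ _) _; rewrite mulrAC mulrC.
    by rewrite ler_wpM2r ?opnorm_ge0.
  rewrite mulrDl [leRHS]addrC; apply: le_trans (lerD h3 h5).
  exact: enorm_sub_absorb.
(* For such $b$ the map [T] moves the centre by at most $(1-k)\,$[rr], so it preserves the ball of
   radius [rr]. *)
exists ((1 - k) * m * rr); first by rewrite !mulr_gt0// subr_gt0.
move=> b hb.
pose T a := a + (b - lx (F (w a))) *m invmx A.
have Tlip a a' : enorm (a - lx q) <= rr -> enorm (a' - lx q) <= rr ->
    enorm (T a - T a') <= k * enorm (a - a').
  move=> h1 h2; have -> : T a - T a' =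
      ((a - a') *m A - (lx (F (w a)) - lx (F (w a')))) *m invmx A.
    rewrite [RHS]mulmxBl mulmxK// /T opprD addrACA -mulmxBl; congr (_ + _).
    by rewrite -mulNmx; congr (_ *m _); rewrite !opprB addrC addrA subrK addrC.
  apply: le_trans (Ainv _) _; rewrite ler_pdivrMl// mulrA [m * k]mulrC km.
  exact: linx.
have T0 : enorm (T (lx q) - lx q) <= (1 - k) * rr.
  rewrite /T addrAC subrr add0r wq; apply: le_trans (Ainv _) _.
  by rewrite ler_pdivrMl// mulrA [m * _]mulrC (ltW hb).
have Tball a : enorm (a - lx q) <= rr -> enorm (T a - lx q) <= rr.
  move=> ar; apply: le_trans (enorm_dist_triangle _ (T (lx q)) _) _.
  have -> : rr = k * rr + (1 - k) * rr by ring.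
  by apply: lerD T0; apply: le_trans (Tlip _ _ ar a0r) _; rewrite ler_wpM2l.
have [a ar Ta] := eball_contraction_fixpoint (ltW rr0) k1 Tball Tlip.
have [Gwa lwa] := inG _ ar.
have Fb : lx (F (w a)) = b.
  move/eqP: Ta; rewrite /T -subr_eq0 addrAC subrr add0r => /eqP.
  move=> /(congr1 (mulmx^~ A)); rewrite mulmxKV// mul0mx => /eqP.
  by rewrite subr_eq0 => /eqP.
exists (w a); split=> //; rewrite -Fb.
set X := enorm (a - lx q).
have hx : (xi - eta) * X <= enorm (lx (F (w a)) - lx (F q)).
  have := linx _ _ ar a0r; rewrite wq -/X => h1; have := mlow_le (a - lx q) A.
  rewrite -/X -/m => h2.
  have := enorm_lowerD ((a - lx q) *m A) (- ((a - lx q) *m A - (lx (F (w a)) - lx (F q)))).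
  rewrite enormN subKr => h3.
  have h4 : (xi + M * opnorm B) * X <= m * X by rewrite ler_wpM2r ?enorm_ge0.
  apply: le_trans h3; apply: le_trans (lerB h2 h1); apply: le_trans (lerB h4 (lexx _)).
  by rewrite -mulrBl ler_wpM2r ?enorm_ge0// opprD addrA addrK.
have hy : enorm (yc (F (w a)) - yc (F q)) <= (M * mu + eta) * X.
  have := le_trans (enorm_yc_le _) (lin _ _ ar a0r).
  rewrite wq -/X ycB mulmx_JacE [yc (row_mx _ _)]row_mxKr ycB lxB lwa ycB.
  set C := dblk F q (iLX s) _; set E := dblk F q _ _ => h1.
  have [h2 _] := wlip _ _ ar a0r; rewrite wq -/X in h2.
  have h3 : enorm ((a - lx q) *m C + (yc (w a) - yc q) *m E) <= M * mu * X.
    apply: le_trans (enormD _ _) _.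
    apply: le_trans (lerD (enorm_mulmx_le _ _) (enorm_mulmx_le _ _)) _.
    apply: le_trans (lerD (lexx _) (ler_wpM2l (opnorm_ge0 _) h2)) _.
    rewrite -/X mulrA -mulrDl ler_wpM2r ?enorm_ge0// -[opnorm C](mulVKf (lt0r_neq0 M0)).
    by rewrite [opnorm E * M]mulrC -mulrDr ler_wpM2l ?(ltW M0)// addrC muF.
  rewrite mulrDl [leRHS]addrC; apply: le_trans (lerD h1 h3).
  by rewrite -{1}[yc (F (w a)) - yc (F q)](subrK ((a - lx q) *m C + (yc (w a) - yc q) *m E)) enormD.
(* It remains to see that $M\mu + \eta \le M(\xi - \eta)$, which is [eta1] rearranged. *)
apply: le_trans hy _; apply: le_trans (ler_wpM2l (ltW M0) hx).
rewrite mulrA ler_wpM2r ?enorm_ge0//.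
move: eta1; rewrite !mulrBr mulrDr mulr1 [eta * M]mulrC.
by move: (M * xi) (M * mu) (M * eta) => x1 x2 x3; lra.
Qed.


(** The local result without the integer translation. The entry condition gives $|y| < R$ at $p$,
    and this room keeps the new point in $D$ when $b$ is close enough. *)
Lemma disk_image_near G p : center_disk G -> disk_image G p ->
  exists2 d : R, 0 < d & forall b, enorm (b - lx p) < d -> enorm (rsubmx b) <= Rad ->
    exists p', [/\ disk_image G p', lx p' = b & enorm (yc p' - yc p) <= M * enorm (b - lx p)].
Proof.
move=> GD Gp; have yp := disk_image_yc GD Gp; case: Gp => Dp [q Gq [n [ni Fq]]].
have DFq : Dl Rad (F q) by rewrite Fq; exact/Dl_shift.
have [d d0 hd] := disk_image_local GD Gq DFq.
exists (Num.min d ((Rad - enorm (yc p)) / M)).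
  by rewrite lt_min d0 divr_gt0// subr_gt0.
move=> b; rewrite lt_min ltr_pdivlMr// => /andP[bd bM] xb.
pose t := Defs.shift u s n.
have E : b + lx t - lx (F q) = b - lx p by rewrite Fq lxD opprD addrACA subrr addr0.
have [|q' [Gq' bq' yq']] := hd (b + lx t); first by rewrite E.
rewrite E in yq'; exists (F q' - t).
have yE : yc (F q' - t) = yc (F q') by rewrite -shiftN yc_shift.
have lE : lx (F q' - t) = b by rewrite lxB bq' addrK.
have yp' : enorm (yc (F q' - t) - yc p) <= M * enorm (b - lx p).
  by rewrite yE; rewrite Fq yc_shift in yq'.
split=> //; split.
  split; first by rewrite /xc -[lsubmx _]/(lx _) lE.
  have := enormD (yc (F q' - t) - yc p) (yc p); rewrite subrK => h.
  apply: le_trans h _; rewrite -lerBrDr; apply: le_trans yp' _.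
  by rewrite mulrC ltW.
by exists q' => //; exists n; rewrite subrK.
Qed.

(** Preimages of the approximating points are translated into a compact fundamental domain and
    accumulate at some $q$. This $q$ lies on the disk, and a translate of its image is the required
    point; the bound [K] survives the limit. *)
Lemma disk_image_closed G (b : 'rV[R]_(c + u)) (y : 'rV[R]_s) (K : R) :
  center_disk G -> enorm (rsubmx b) <= Rad ->
  (forall e : R, 0 < e -> exists p,
     [/\ disk_image G p, enorm (lx p - b) < e & enorm (yc p - y) <= K]) ->
  exists p, [/\ disk_image G p, lx p = b & enorm (yc p - y) <= K].
Proof.
move=> GD xb h; case: (GD) => Gdom Gsh Glip Gtot.
pose A (e : R) q := exists p, [/\ G q, Defs.equivP (F q) p, Dl Rad p,
  enorm (lx p - b) < e & enorm (yc p - y) <= K].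
have [|q [Dq _] hq] := @compact_cluster_family R _ _ A (@compact_fundamental R c u s Rad c%:R).
  move=> e e0; have [p [[Dp [q Gq Fq]] pb py]] := h e e0.
  have [n [ni nq]] := fundamental_translate q.
  exists (q + Defs.shift u s n).
  have Gq' := Gsh _ _ Gq ni; split; first by split=> //; exact: center_disk_Dl GD Gq'.
  exists p; split=> //; have [m [mi ->]] := liftF (center_disk_Dl GD Gq) ni.
  exact: equivP_trans (equivP_shift _ mi) Fq.
(* A Lipschitz graph is closed: $q$ is compared with the point of the disk above [lx q] through
   nearby points of the disk. *)
have Gq : G q.
  have [|q' Gq' qq'] := Gtot (lx q); first by have [] := Dq.
  suff -> : q = q' by [].
  apply: lx_yc_inj => //; apply/eqP; rewrite -subr_eq0; apply/eqP/enorm_le0.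
  apply/ler_addgt0Pr => e e0; rewrite add0r.
  have M1 : 0 < 1 + M by rewrite addr_gt0.
  have [|e' [q2 [_ _ [p [Gq2 _ _ _ _]] q2q]]] := hq (e / (1 + M)); first by rewrite divr_gt0.
  rewrite ltr_pdivlMr// in q2q; apply: le_trans (ltW q2q).
  apply: le_trans (enorm_dist_triangle _ (yc q2) _) _.
  rewrite mulrDr mulr1 enormB -ycB lerD ?enorm_yc_le//.
  apply: le_trans (Glip _ _ Gq2 Gq') _; rewrite mulrC qq' -lxB.
  by rewrite ler_wpM2r ?(ltW M0)// enorm_lx_le.
have near (e : R) : 0 < e -> exists p n, [/\ intvec n, enorm (F q - p - Defs.shift u s n) < e,
    enorm (lx p - b) < e & enorm (yc p - y) <= K /\ enorm (yc p) <= Rad].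
  move=> e0; have [d d0 hd] := continuous_Dl r0 CF Dq e0.
  have [|e' [q2 [/andP[e'0 e'd] _ [p [Gq2 [n [ni Fq2]] Dp pb py]] q2q]]] := hq (Num.min d e).
    by rewrite lt_min d0.
  rewrite !lt_min in e'd q2q; case/andP: e'd => _ e'e; case/andP: q2q => q2d _.
  exists p, n; split=> //; [|exact: lt_trans pb e'e|by split=> //; case: Dp].
  by rewrite -addrA -opprD -Fq2 enormB; exact: hd.
have small (x : R) : (forall e : R, 0 < e -> x <= e) -> x <= 0.
  by move=> hx; apply/ler_addgt0Pr => e e0; rewrite add0r hx.
(* The only translation that can bring [F q] over $b$. It is a limit of integer vectors, hence an
   integer vector. *)
pose v := lam (F q) - lsubmx b.
have vi : intvec v.
  apply: intvec_closed => e e0; have [|p [n [ni Fn pb _]]] := near (e / 2); first by rewrite divr_gt0.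
  exists n => //; rewrite enormB.
  have := le_trans (enorm_lam_le _) (enorm_lx_le (F q - p - Defs.shift u s n)).
  rewrite !lamB lam_mkpt => h1; have := enorm_lsubmx (lx p - b).
  rewrite linearB /= -[lsubmx (lx p)]/(lam p) => h2.
  have -> : v - n = (lam (F q) - lam p - n) + (lam p - lsubmx b).
    by rewrite /v [RHS]addrAC subrKA.
  apply: le_lt_trans (enormD _ _) _; move: (enorm _) (enorm _) (enorm _) (enorm _) h1 h2 Fn pb.
  by move=> a1 a2 a3 a4; lra.
pose p := F q + Defs.shift u s (- v).
have xp : xc (F q) = rsubmx b.
  apply/eqP; rewrite -subr_eq0; apply/eqP/enorm_le0/small => e e0.
  have [|p' [n [ni Fn pb _]]] := near (e / 2); first by rewrite divr_gt0.
  have := le_trans (enorm_xc_le _) (enorm_lx_le (F q - p' - Defs.shift u s n)).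
  rewrite !xcB xc_mkpt subr0 => h1; have := enorm_rsubmx (lx p' - b).
  rewrite linearB /= -[rsubmx (lx p')]/(xc p') => h2.
  have := enorm_dist_triangle (xc (F q)) (xc p') (rsubmx b).
  move: (enorm _) (enorm _) (enorm _) (enorm _) (enorm _) h1 h2 Fn pb.
  by move=> a1 a2 a3 a4 a5; lra.
have lp : lx p = b.
  by rewrite lx_lam_xc xc_shift lam_shift xp /v opprB addrC subrK hsubmxK.
have yp : enorm (yc p - y) <= K.
  rewrite yc_shift; apply/ler_addgt0Pr => e e0.
  have [p' [n [ni Fn _ [py _]]]] := near e e0.
  have := enorm_yc_le (F q - p' - Defs.shift u s n); rewrite !ycB yc_mkpt subr0 => h1.
  have := enorm_dist_triangle (yc (F q)) (yc p') y.
  move: (enorm _) (enorm _) (enorm _) (enorm _) h1 Fn py.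
  by move=> a1 a2 a3 a4; lra.
have Fqp : Defs.equivP (F q) p by apply: equivP_sym; apply: equivP_shift; exact: intvecN.
exists p; split=> //; split; last by exists q.
split; first by rewrite xc_shift xp.
rewrite yc_shift; apply/ler_addgt0Pr => e e0.
have [p' [n [ni Fn _ [_ py]]]] := near e e0.
have := enorm_yc_le (F q - p' - Defs.shift u s n); rewrite !ycB yc_mkpt subr0 => h1.
have := enormD (yc (F q) - yc p') (yc p'); rewrite subrK.
move: (enorm _) (enorm _) (enorm _) (enorm _) h1 Fn py.
by move=> a1 a2 a3 a4; lra.
Qed.

(** Open-and-closed argument along the segment from [lx p0] to $b$, which stays over the convex
    $x$-ball. The cone estimate is carried along with existence, so local Lipschitz bounds add up to
    a global one. *)
Lemma disk_image_reach G p0 (b : 'rV[R]_(c + u)) :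
  center_disk G -> disk_image G p0 -> enorm (rsubmx b) <= Rad ->
  exists p, [/\ disk_image G p, lx p = b & enorm (yc p - yc p0) <= M * enorm (b - lx p0)].
Proof.
move=> GD Gp0 xb; pose a := lx p0; pose l (t : R) := a + t *: (b - a).
have xa : enorm (rsubmx a) <= Rad by case: Gp0 => -[].
have xl t : 0 <= t <= 1 -> enorm (rsubmx (l t)) <= Rad.
  move=> /andP[t0 t1]; have -> : l t = (1 - t) *: a + t *: b.
    by rewrite /l scalerBr scalerBl scale1r addrA addrAC.
  rewrite linearD !linearZ /=; apply: le_trans (enormD _ _) _.
  rewrite !enormZ !ger0_norm ?subr_ge0//.
  have -> : Rad = (1 - t) * Rad + t * Rad by ring.
  by rewrite lerD// ler_wpM2l ?subr_ge0.
have lB t t' : l t' - l t = (t' - t) *: (b - a).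
  by rewrite /l opprD addrACA subrr add0r scalerBl.
pose S t := exists p, [/\ disk_image G p, lx p = l t &
  enorm (yc p - yc p0) <= M * (t * enorm (b - a))].
suff : S 1.
  move=> [p [Gp pl yp]]; exists p; split=> //; first by rewrite pl /l scale1r addrC subrK.
  by rewrite mul1r in yp.
apply: unit_interval_induction.
- by exists p0; split=> //; rewrite ?/l ?scale0r ?addr0// subrr enorm0 mul0r mulr0.
- move=> t /andP[t0 t1] [p [Gp pl yp]].
  have [d d0 hd] := disk_image_near GD Gp.
  have n1 : 0 < enorm (b - a) + 1 by rewrite ltr_wpDl ?enorm_ge0.
  (* The step does not pass beyond 1 and displaces the base point by less than $d$. *)
  pose e := Num.min (1 - t) (d / 2 / (enorm (b - a) + 1)).
  have e0 : 0 < e by rewrite lt_min subr_gt0 t1 !divr_gt0.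
  have e1 : e <= 1 - t by rewrite ge_min lexx.
  have e2 : e * enorm (b - a) < d.
    have : e <= d / 2 / (enorm (b - a) + 1) by rewrite ge_min lexx orbT.
    rewrite ler_pdivlMr// mulrDr mulr1; move: (e * _) => x.
    by move: e0 d0; move: (e) (d) => e' d'; lra.
  have t'1 : 0 <= t + e <= 1.
    by rewrite addr_ge0 ?(ltW e0)//= -lerBrDl.
  have lE : enorm (l (t + e) - lx p) = e * enorm (b - a).
    by rewrite pl lB addrAC subrr add0r enormZ ger0_norm ?(ltW e0).
  have [|p' [Gp' pl' yp']] := hd (l (t + e)) _ (xl _ t'1); first by rewrite lE.
  exists (t + e); first by rewrite ltrDl e0; case/andP: t'1.
  exists p'; split=> //; rewrite lE in yp'.
  apply: le_trans (enorm_dist_triangle _ (yc p) _) _.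
  by rewrite mulrDl mulrDr addrC lerD.
- move=> t t01 h; apply: (disk_image_closed GD (xl _ t01)) => e e0.
  have n1 : 0 < enorm (b - a) + 1 by rewrite ltr_wpDl ?enorm_ge0.
  have [|t' /andP[t't tt'] [t'0 [p [Gp pl yp]]]] := h (e / (enorm (b - a) + 1)).
    by rewrite divr_gt0.
  exists p; split=> //.
    rewrite pl lB enormZ distrC ger0_norm ?subr_ge0//.
    apply: (@le_lt_trans _ _ ((t - t') * (enorm (b - a) + 1))).
      by rewrite ler_wpM2l ?subr_ge0// lerDl.
    by rewrite -ltr_pdivlMr// ltrBlDr -ltrBlDl.
  apply: le_trans yp _; rewrite ler_wpM2l ?(ltW M0)//.
  by rewrite ler_wpM2r ?enorm_ge0.
Qed.

(* Two points of the image with the same (lambda, x) lie in a stable cone, hence so do their preimages;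
   as M < L, this cone meets the M-Lipschitz disk G only at its vertex. *)
Lemma disk_image_unique G p p' : center_disk G -> disk_image G p -> disk_image G p' ->
  lx p = lx p' -> p = p'.
Proof.
move=> GD [Dp [q Gq [n [ni Fq]]]] [Dp' [q' Gq' [n' [n'i Fq']]]] pp.
have L0 : 0 < L by exact: lt_trans ML.
have Dq := center_disk_Dl GD Gq; have Dq' := center_disk_Dl GD Gq'.
case: (GD) => _ Gsh Glip _.
have [|||m [mi mE]] := bcF Dq Dq'.
- by rewrite Fq; exact/Dl_shift.
- by rewrite Fq'; exact/Dl_shift.
(* This translation cancels the two shifts between the images and $p$, $p'$, so the $(\lambda,x)$
   difference becomes 0. *)
- exists (n' - n); split; first by apply: intvecD => //; exact: intvecN.
  have lpp : lam p = lam p' by rewrite -[lam p]/(lsubmx (lx p)) pp.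
  have xpp : xc p = xc p' by rewrite -[xc p]/(rsubmx (lx p)) pp.
  rewrite Fq Fq' !xc_shift !lam_shift lpp xpp [lam p' + n + _]addrA.
  rewrite [lam p' + n + n']addrAC addrK !subrr row_mx0 enorm0.
  by rewrite mulr_ge0 ?enorm_ge0 ?invr_ge0 ?(ltW L0).
have lE : row_mx (lam q + m - lam q') (xc q - xc q') = lx (q + Defs.shift u s m) - lx q'.
  by rewrite [lx (_ + _)]lx_lam_xc [lx q']lx_lam_xc lam_shift xc_shift opp_row_mx add_row_mx.
rewrite lE in mE; have Gqm := Gsh _ _ Gq mi.
have := Glip _ _ Gqm Gq'; rewrite yc_shift => h1.
have qq : lx (q + Defs.shift u s m) = lx q'.
  apply/eqP; rewrite -subr_eq0; apply/eqP/enorm_le0; set X := enorm _ in mE h1 *.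
  rewrite leNgt; apply/negP => X0.
  have : L * X <= M * X by apply: le_trans h1; rewrite -ler_pdivlMl.
  by rewrite ler_pM2r// leNgt ML.
have qE : q + Defs.shift u s m = q' by exact: center_disk_eq GD Gqm Gq' qq.
have [m' [m'i Fm]] := liftF Dq mi; rewrite qE in Fm.
apply: lx_yc_inj => //.
have : yc (F q') = yc (F q) by rewrite Fm yc_shift.
by rewrite Fq Fq' !yc_shift.
Qed.

(** Following the segment from $q$ yields a point above [lx p] with the Lipschitz bound; by
    uniqueness this point is $p$ itself. Totality follows in the same way from [p0]. *)
Lemma disk_image_center_disk G p0 : center_disk G -> disk_image G p0 ->
  center_disk (disk_image G).
Proof.
move=> GD Gp0; split.
- by move=> p Gp; split; [case: Gp => -[]|exact: disk_image_yc GD Gp].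
- move=> p n [Dp [q Gq Fq]] ni; split; first exact/Dl_shift.
  exists q => //; apply: equivP_trans Fq _; apply: equivP_sym; exact: equivP_shift.
- move=> p q Gp Gq; have [|p' [Gp' pp' yp']] := @disk_image_reach G q (lx p) GD Gq.
    by case: Gp => -[].
  by rewrite (disk_image_unique GD Gp Gp' (esym pp')) pp'.
- by move=> a xa; have [p [Gp pa _]] := disk_image_reach GD Gp0 xa; exists p.
Qed.

End GraphTransform.

(** * Finite backward orbits and the conditions read off from covering *)

Section Trajectories.
Variables (R : realType) (c u s : nat).
Local Notation P := 'rV[R]_(c + u + s).
Variables (Rad L : R) (F : P -> P) (r : nat).
Hypotheses (Rad0 : 0 < Rad) (L0 : 0 < L) (r0 : (0 < r)%N).
Hypotheses (liftF : is_lift Rad F) (CF : Cr_map r Rad F) (bcF : backward_cone Rad L F).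
Implicit Types (p q z w v : P).

(** Backward orbits of finite length, modulo integer translations: the points of the $n$-th disk are
    only known to have $n$ preimages in $D$. *)
Fixpoint back_chain (n : nat) p : Prop :=
  Dl Rad p /\ if n is m.+1 then exists2 q, back_chain m q & Defs.equivP (F q) p else True.

Lemma back_chain_Dl n p : back_chain n p -> Dl Rad p.
Proof. by case: n => [|n] []. Qed.

Lemma back_chain_shift n p m : back_chain n p -> intvec m -> back_chain n (p + Defs.shift u s m).
Proof.
move=> + mi; case: n => [|n] [Dp hp]; first by split=> //; exact/Dl_shift.
split; first exact/Dl_shift.
case: hp => q hq Fq; exists q => //.
by apply: equivP_trans Fq _; apply: equivP_sym; exact: equivP_shift.
Qed.

Lemma Wcu_back_chain z n : Wcu Rad F z -> back_chain n z.
Proof.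
move=> [zs [<- hz]]; elim: n 0%N => [|n IH] i /=; first by split=> //; exact: (hz i).1.
by split; [exact: (hz i).1|exists (zs i.+1); [exact: IH|exact: (hz i).2]].
Qed.

(** The backward cone condition passes the stable cone to the preimages, and each forward step
    contracts the $y$ difference by [mu_s1]. At the far end the difference is at most $2R$. *)
Lemma back_chain_stable_cone n p z : back_chain n p -> back_chain n z ->
  enorm (lx p - lx z) <= L^-1 * enorm (yc p - yc z) ->
  enorm (yc p - yc z) <= mu_s1 Rad L F ^+ n * (Rad + Rad).
Proof.
elim: n p z => [|n IH] p z hp hz cone.
  rewrite expr0 mul1r; have [_ yp] := back_chain_Dl hp; have [_ yz] := back_chain_Dl hz.
  by apply: le_trans (enormBD _ _) _; exact: lerD.
case: hp hz => Dp [q hq [n1 [n1i Fq]]] [Dz [q' hq' [n2 [n2i Fq']]]].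
have [Dq Dq'] := (back_chain_Dl hq, back_chain_Dl hq').
have [|||m [mi mE]] := bcF Dq Dq'.
- by rewrite Fq; exact/Dl_shift.
- by rewrite Fq'; exact/Dl_shift.
- exists (n2 - n1); split; first by apply: intvecD => //; exact: intvecN.
  rewrite Fq Fq' !xc_shift !lam_shift !yc_shift.
  have -> : lam p + n1 + (n2 - n1) - (lam z + n2) = lam p - lam z.
    by rewrite [n2 - n1]addrC addrA addrK opprD addrACA subrr addr0.
  by move: cone; rewrite !lx_lam_xc opp_row_mx add_row_mx.
have lE : row_mx (lam q + m - lam q') (xc q - xc q') = lx (q + Defs.shift u s m) - lx q'.
  by rewrite [lx (_ + _)]lx_lam_xc [lx q']lx_lam_xc lam_shift xc_shift opp_row_mx add_row_mx.
(* The induction hypothesis is applied to the lift of the preimage that shares a chart with $q'$. *)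
rewrite lE -(yc_shift q m) in mE; have hqm := back_chain_shift hq mi.
have h1 := IH _ _ hqm hq' mE.
have h2 := stable_cone_contraction Rad0 r0 liftF CF L0 (back_chain_Dl hqm) Dq' mE.
have [m' [m'i Fm]] := liftF Dq mi.
rewrite Fm Fq Fq' !yc_shift in h2; rewrite yc_shift in h1.
apply: le_trans h2 _; rewrite exprS -mulrA ler_wpM2l//.
exact: (mu_M_ge0 Rad0 r0 liftF CF L0).
Qed.

(** The homotopy is evaluated at time 0 at the vertex $q$ of its own cone $U$, where it agrees with
    $F$ up to an integer translation. [covering_entry] uses the same evaluation. *)
Lemma covering_exit q : covering Rad L F -> Dl Rad q ->
  enorm (xc q) = Rad -> enorm (yc q) < Rad -> ~ Dl Rad (F q).
Proof.
move=> cov Dq xq yq DFq; have [lst [h [A [[_ hl h0 _] [hm _ _]]]]] := cov _ Dq.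
have Uq : Uset Rad L q q by split=> //; rewrite !subrr !enorm0 mulr0.
have a01 : 0 <= (0 : R) <= 1 by rewrite lexx ler01.
have [xh yh] := equivP_Dl (h0 _ Uq) DFq.
apply: (hm 0 q a01 Uq _ xq yq).
  by rewrite subrr enorm0 /RLam invr_ge0.
by split=> //; exact: ltW (hl _ _ a01 Uq).
Qed.

Lemma covering_entry q : covering Rad L F -> Dl Rad q -> Dl Rad (F q) ->
  enorm (yc (F q)) < Rad.
Proof.
move=> cov Dq DFq; have [lst [h [A [[_ hl h0 _] [_ hp _]]]]] := cov _ Dq.
have Uq : Uset Rad L q q by split=> //; rewrite !subrr !enorm0 mulr0.
have a01 : 0 <= (0 : R) <= 1 by rewrite lexx ler01.
have [n [_ hE]] := h0 _ Uq; have := hp 0 q a01 Uq.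
rewrite {2 3}hE xc_shift yc_shift => np.
rewrite lt_neqAle DFq.2 andbT; apply/eqP => yR; apply: np.
by split=> //; [exact: ltW (hl _ _ a01 Uq)|exact: DFq.1].
Qed.

End Trajectories.

(** * The initial disk and the limit of the approximating disks *)

Lemma flat_center_disk (R : realType) (c u s : nat) (Rad M : R) (y : 'rV[R]_s) :
  0 < M -> enorm y < Rad ->
  @center_disk R c u s Rad M (fun p => enorm (xc p) <= Rad /\ yc p = y).
Proof.
move=> M0 yR; split.
- by move=> p [xp ->].
- by move=> p n [xp yp] _; rewrite xc_shift yc_shift.
- by move=> p q [_ ->] [_ ->]; rewrite subrr enorm0 mulr_ge0 ?enorm_ge0 ?(ltW M0).
- move=> a xa; exists (row_mx a y); last by rewrite /lx row_mxKl.
  by rewrite /xc /yc row_mxKl row_mxKr.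
Qed.

Theorem theorem3p4 (R : realType) (c u s k : nat) (Rad L M : R)
  (F : 'rV[R]_(c + u + s) -> 'rV[R]_(c + u + s)) :
  (0 < c)%N -> (0 < u)%N -> (0 < s)%N -> (1 <= k)%N ->
  0 < Rad -> Rad < (RLam R) / 2 ->
  2 * Rad / (RLam R) < L -> L < 1 ->
  is_lift Rad F -> Cr_map k.+1 Rad F ->
  covering Rad L F -> rate_conditions Rad L F k -> backward_cone Rad L F ->
  0 < M -> M < L ->
  1 < xi_M Rad F M / mu_M Rad F M ->
  forall z1 z2, Wcu Rad F z1 -> Wcu Rad F z2 ->
    enorm (lam z1 - lam z2) <= (RLam R) ->
    enorm (yc z1 - yc z2) <= M * enorm (lx z1 - lx z2).
Proof.
move=> _ _ _ k1 Rad0 _ RL L1 liftF CF cov rates bcF M0 ML ximu z1 z2 W1 W2 _.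
have L0 : 0 < L by exact: lt_trans ML.
have r0 : (0 < k.+1)%N by [].
have mu0 := mu_M_ge0 Rad0 r0 liftF CF M0.
have mup : 0 < mu_M Rad F M.
  (* Division by 0 yields 0, so a ratio above 1 excludes $\mu = 0$. *)
  rewrite lt_neqAle mu0 andbT eq_sym; apply/eqP => mu00.
  by move: ximu; rewrite mu00 invr0 mulr0 ltr10.
have muxi : mu_M Rad F M < xi_M Rad F M by move: ximu; rewrite ltr_pdivlMr// mul1r.
have exitF q : Dl Rad q -> enorm (xc q) = Rad -> enorm (yc q) < Rad -> ~ Dl Rad (F q).
  exact: covering_exit cov.
have entryF q : Dl Rad q -> Dl Rad (F q) -> enorm (yc (F q)) < Rad.
  exact: covering_entry cov.
have xiF q (Dq : Dl Rad q) := xi_M_le Rad0 r0 liftF CF M0 Dq.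
have muF q (Dq : Dl Rad q) := mu_s1_ge Rad0 r0 liftF CF M0 Dq.
(* Induction on $n$ for all trajectories at once: the disk through the first backward iterate is
   built from the shifted trajectory and mapped forward once. *)
have disks n z : Wcu Rad F z -> exists G,
    [/\ center_disk Rad M G, G z & forall p, G p -> back_chain Rad F n p].
  move=> [zs [<- hz]]; elim: n zs hz {z} => [|n IH] zs hz.
    (* Every point of a trajectory is an image of a point of $D$, so the entry condition gives the
       strict bound required of a flat disk. *)
    have y0 : enorm (yc (zs 0%N)) < Rad.
      have [D0 [m [mi E]]] := hz 0%N; have := entryF _ (hz 1%N).1.
      by rewrite E yc_shift; apply; exact/Dl_shift.
    exists (fun p => enorm (xc p) <= Rad /\ yc p = yc (zs 0%N)); split.
    - exact: flat_center_disk.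
    - by split=> //; exact: (hz 0%N).1.1.
    - by move=> p [xp yp]; split=> //; split=> //; rewrite yp ltW.
  have [G [GD G1 Gn]] := IH (fun i => zs i.+1) (fun i => hz i.+1).
  have G0 : disk_image Rad F G (zs 0%N).
    by split; [exact: (hz 0%N).1|exists (zs 1%N); [|exact: (hz 0%N).2]].
  exists (disk_image Rad F G); split=> //.
    exact: (disk_image_center_disk r0 M0 ML liftF CF bcF exitF entryF mu0 muxi xiF muF GD G0).
  by move=> p [Dp [q Gq Fq]]; split=> //; exists q => //; exact: Gn.
have approx n : enorm (yc z1 - yc z2) <=
    M * enorm (lx z1 - lx z2) + mu_s1 Rad L F ^+ n * (Rad + Rad).
  have [G [[_ _ Glip Gtot] G1 Gn]] := disks n z1 W1.
  have h2 := Wcu_back_chain n W2; have [x2 _] := back_chain_Dl h2.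
  (* The point of the disk directly above the base of [z2]: the Lipschitz bound compares it with
     [z1], and the stable cone, in which it lies trivially, compares it with [z2]. *)
  have [p Gp pz] := Gtot (lx z2) x2.
  apply: le_trans (enorm_dist_triangle _ (yc p) _) (lerD _ _).
    by rewrite -pz; exact: Glip.
  apply: (back_chain_stable_cone Rad0 L0 r0 liftF CF bcF (Gn _ Gp) h2).
  by rewrite pz subrr enorm0 mulr_ge0 ?enorm_ge0 ?invr_ge0 ?(ltW L0).
have [_ [_ [[mus1 _ _ _] _]]] := rates.
have mus0 : 0 <= mu_s1 Rad L F := mu_M_ge0 Rad0 r0 liftF CF L0.
have RR : 0 < Rad + Rad by rewrite addr_gt0.
apply/ler_addgt0Pr => e e0.
(* Since [mu_s1] is below 1, some $n$ makes the remaining term smaller than $e$. *)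
have /cvg_expr/cvgrPdist_lt/(_ (e / (Rad + Rad))) : `|mu_s1 Rad L F| < 1 by rewrite ger0_norm.
rewrite divr_gt0// => /(_ isT)/filter_ex[n].
rewrite sub0r normrN ger0_norm ?exprn_ge0// ltr_pdivlMr// => hn.
by apply: le_trans (approx n) _; rewrite lerD2l ltW.
Qed.
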